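(* Consider FedAvg with full participation of $m$ clients, $E$ local steps per round and a finite learning rate $\eta>0$. Let $\mathcal{L}_{jk}(\omega)$ be the loss of the mini-batch used at the $k$-th step of the $j$-th client ($0\le j\le m-1$, $0\le k\le E-1$), $\mathcal{L}_j=\frac1E\sum_{k=0}^{E-1}\mathcal{L}_{jk}$ and $\mathcal{L}=\frac1m\sum_{j=0}^{m-1}\mathcal{L}_j$. If the local parameters of the clients are discretely updated with the finite learning rate $\eta$, then the expectation of the discrete updates of the aggregated parameter in FedAvg follows the modified loss $\tilde{\mathcal{L}}_{FedAvg}(\omega)$, which can be expressed as $$\tilde{\mathcal{L}}_{FedAvg}(\omega)\approx\mathcal{L}(\omega)-\frac{E\eta}{4m}\sum_{j=0}^{m-1}\|\nabla\mathcal{L}(\omega)-\nabla\mathcal{L}_j(\omega)\|^2+\frac{\eta}{4mE}\sum_{j=0}^{m-1}\sum_{k=0}^{E-1}\|\nabla\mathcal{L}_{jk}(\omega)\|^2 .$$ The approximation holds when $\eta\ll 1/E$. If $E=1$, the modified loss is the same as the one of SGD.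
   Context: $\|\cdot\|$ is the Euclidean norm and $\nabla$ is the gradient with respect to the parameter $\omega$. One round of FedAvg with full participation: every client $j$ starts from the common global parameter $\omega^j_0=\omega_0$ and performs $E$ local steps $\omega^j_{k+1}=\omega^j_k-\eta\nabla\mathcal{L}_{jk}(\omega^j_k)$, $k=0,\dots,E-1$; the server then averages, $\omega_E=\frac1m\sum_{j=0}^{m-1}\omega^j_E$. The mini-batches of each client are randomly shuffled, and the expectation $\mathbb{E}$ is over their order. Meaning of ''follows the modified loss'' (backward error analysis): the modified flow is $\dot\omega=-\nabla\tilde{\mathcal{L}}_{FedAvg}(\omega)$, and it is determined by requiring that its solution started at $\omega_0$ agree after time $E\eta$ with the expected parameter $\mathbb{E}(\omega_E)$ after one round. Meaning of ''$\approx$'': the small parameter is $E\eta$. The learning rate is assumed large enough that terms of order $E^2\eta^2$ in the parameter update over one round are significant, but small enough that terms of order $O(E^3\eta^3)$ in that update are neglected. Correspondingly, only the correction to $\mathcal{L}$ of first order in $\eta$ is kept in $\tilde{\mathcal{L}}_{FedAvg}$. Modified loss of SGD: for (centralized) SGD with learning rate $\eta$ on a loss $\mathcal{L}=\frac1E\sum_{k=0}^{E-1}\mathcal{L}_k$, where $\mathcal{L}_k$ is the loss of the $k$-th of the $E$ mini-batches of one epoch, the modified loss is $\tilde{\mathcal{L}}_{SGD}(\omega)\approx\mathcal{L}(\omega)+\frac{\eta}{4E}\sum_{k=0}^{E-1}\|\nabla\mathcal{L}_k(\omega)\|^2$. *)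

(* Defs.v *)
From HB Require Import structures.
From mathcomp Require Import all_boot all_order all_algebra all_fingroup.
From mathcomp Require Import all_classical all_reals all_analysis.

Set Implicit Arguments.
Unset Strict Implicit.
Unset Printing Implicit Defensive.
Import Order.TTheory GRing.Theory Num.Theory.
Import numFieldNormedType.Exports.
Local Open Scope classical_set_scope.
Local Open Scope ring_scope.

(* The library norm on 'rV[R]_d is the sup norm. *)
Definition enorm (R : realType) (d : nat) (v : 'rV[R]_d) : R :=
  Num.sqrt (\sum_(i < d) v 0 i ^+ 2).

Definition partial (R : realType) (d : nat) (i : 'I_d) (f : 'rV[R]_d -> R)
    : 'rV[R]_d -> R :=
  fun w => 'D_(delta_mx 0 i) f w.

Definition grad (R : realType) (d : nat) (f : 'rV[R]_d -> R) (w : 'rV[R]_d)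
    : 'rV[R]_d :=
  \row_(i < d) partial i f w.

(* Class C^n on the whole space, by recursion on the partial derivatives. *)
Fixpoint Ck (R : realType) (d n : nat) (f : 'rV[R]_d -> R) : Prop :=
  match n with
  | 0 => continuous f
  | n'.+1 => (forall w, differentiable f w) /\ forall i, Ck n' (partial i f)
  end.

(* On A, all partial derivatives of f of orders 1, ..., n are bounded by M. *)
Fixpoint partials_bounded (R : realType) (d n : nat) (A : set 'rV[R]_d) (M : R)
    (f : 'rV[R]_d -> R) : Prop :=
  match n with
  | 0 => True
  | n'.+1 => forall i, (forall w, A w -> `|partial i f w| <= M) /\
                       partials_bounded n' A M (partial i f)
  end.

Definition client_loss (R : realType) (d m E : nat)
    (L : 'I_m -> 'I_E -> 'rV[R]_d -> R) (j : 'I_m) : 'rV[R]_d -> R :=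
  fun w => E%:R^-1 * \sum_(k < E) L j k w.

Definition global_loss (R : realType) (d m E : nat)
    (L : 'I_m -> 'I_E -> 'rV[R]_d -> R) : 'rV[R]_d -> R :=
  fun w => m%:R^-1 * \sum_(j < m) client_loss L j w.

(* enum 'I_E is increasing, and step k uses the mini-batch number s k. *)
Definition local_update (R : realType) (d E : nat) (l : 'I_E -> 'rV[R]_d -> R)
    (s : 'S_E) (eta : R) (w0 : 'rV[R]_d) : 'rV[R]_d :=
  foldl (fun w k => w - eta *: grad (l (s k)) w) w0 (enum 'I_E).

Definition fedavg_round (R : realType) (d m E : nat)
    (L : 'I_m -> 'I_E -> 'rV[R]_d -> R) (s : {ffun 'I_m -> 'S_E})
    (eta : R) (w0 : 'rV[R]_d) : 'rV[R]_d :=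
  m%:R^-1 *: \sum_(j < m) local_update (L j) (s j) eta w0.

(* The clients shuffle their mini-batches uniformly and independently, i.e. the
   family of orders is uniform on {ffun 'I_m -> 'S_E}. *)
Definition expected_round (R : realType) (d m E : nat)
    (L : 'I_m -> 'I_E -> 'rV[R]_d -> R) (eta : R) (w0 : 'rV[R]_d) : 'rV[R]_d :=
  #|{ffun 'I_m -> 'S_E}|%:R^-1 *:
    \sum_(s : {ffun 'I_m -> 'S_E}) fedavg_round L s eta w0.

(* At the endpoints 0 and T only continuity of g is required. *)
Definition gradient_flow (R : realType) (d : nat) (F : 'rV[R]_d -> R)
    (w0 : 'rV[R]_d) (T : R) (g : R -> 'rV[R]_d) : Prop :=
  [/\ g 0 = w0,
      {within `[0, T], continuous g} &
      forall t, 0 < t < T -> is_derive t 1 g (- grad F (g t))].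

(* The existence clause rules out a vacuous comparison; C and delta are
   parameters so that their dependence on the data can be quantified. *)
Definition flow_matches_round (R : realType) (d m E : nat)
    (L : 'I_m -> 'I_E -> 'rV[R]_d -> R) (Lt : R -> 'rV[R]_d -> R)
    (C delta : R) (w0 : 'rV[R]_d) : Prop :=
  forall eta : R, 0 < eta -> E%:R * eta <= delta ->
    (exists g, gradient_flow (Lt eta) w0 (E%:R * eta) g) /\
    (forall g, gradient_flow (Lt eta) w0 (E%:R * eta) g ->
       enorm (g (E%:R * eta) - expected_round L eta w0)
         <= C * (E%:R * eta) ^+ 3).

(* The modified loss keeps only the first-order correction in eta; it is
   determined by matching the expected round up to O((E * eta)^3). *)
Definition is_modified_loss (R : realType) (d m E : nat)
    (L : 'I_m -> 'I_E -> 'rV[R]_d -> R) (Lt : R -> 'rV[R]_d -> R) : Prop :=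
  (exists F1 : 'rV[R]_d -> R, Ck 1 F1 /\
     forall eta w, Lt eta w = global_loss L w + eta * F1 w) /\
  (forall w0, exists C delta : R,
     0 < delta /\ flow_matches_round L Lt C delta w0).

Definition fedavg_modified_loss (R : realType) (d m E : nat)
    (L : 'I_m -> 'I_E -> 'rV[R]_d -> R) (eta : R) (w : 'rV[R]_d) : R :=
  global_loss L w
  - (E%:R * eta) / (4 * m%:R) *
      \sum_(j < m) enorm (grad (global_loss L) w - grad (client_loss L j) w) ^+ 2
  + eta / (4 * m%:R * E%:R) *
      \sum_(j < m) \sum_(k < E) enorm (grad (L j k) w) ^+ 2.

Definition sgd_loss (R : realType) (d E : nat) (l : 'I_E -> 'rV[R]_d -> R)
    : 'rV[R]_d -> R :=
  fun w => E%:R^-1 * \sum_(k < E) l k w.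

Definition sgd_modified_loss (R : realType) (d E : nat)
    (l : 'I_E -> 'rV[R]_d -> R) (eta : R) (w : 'rV[R]_d) : R :=
  sgd_loss l w + eta / (4 * E%:R) * \sum_(k < E) enorm (grad (l k) w) ^+ 2.

(* Main.v *)
(* Both the flow of a loss and one round are expanded to second order at w0,
   with h = E * eta and errors O(h^3).  A shuffled local run of client j gives
     w0 - eta * sum_k g_jk + eta^2 * sum_(k' before k) H_jk g_jk' ,
   and averaging each order with its reverse replaces the ordered sum by one
   half of (sum_k H_jk) (sum_k g_jk) - sum_k H_jk g_jk.  The flow of the loss
   corrected by eta * F1 gives w0 - h (g + eta * grad F1) + h^2/2 H g.  Since
   2 H g is the gradient of |g|^2 (symmetry of the Hessian), equating the
   h^2 terms determines grad F1, hence F1 up to a constant.  Every bound comes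
   from the bounds on the partial derivatives of a single mini-batch loss,
   which are inherited by averages: this makes the constants independent of m
   and E. *)
Require Import Defs.
From HB Require Import structures.
From mathcomp Require Import all_boot all_order all_algebra all_fingroup.
From mathcomp Require Import all_classical all_reals all_analysis.
From mathcomp Require Import ring lra.
Import Order.TTheory GRing.Theory Num.Theory.
Import numFieldNormedType.Exports.
Local Open Scope classical_set_scope.
Local Open Scope ring_scope.
Set Implicit Arguments.
Unset Strict Implicit.

(** * Paths in the parameter space *)

(** The mini-batch losses carry no global bounds, so a flow could leave every region where their
    derivatives are controlled. All estimates are therefore made on a ball of radius [rho] around
    [w0]: there one [M] bounds all partials up to order 3, and a speed bound [B] with [B * T < rho]
    traps every flow. Existence comes from Picard iteration on the field precomposed with a
    retraction onto a smaller ball. The gradient of the correction is [E%:R *: drift], where [drift]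
    is bounded independently of [m] and [E]. Hence the factor [eta] in front of it becomes
    [h = E * eta], the size needed to act at order [h^2]. In the uniqueness part a candidate [F1] is
    only C^1, so its gradient has no Lipschitz constant. Continuity leaves an error [h * eta * e]
    instead of [O(h^3)]; dividing by [h * eta] and letting [e] tend to 0 is still enough. The
    analysis uses the sup norm, for which vector estimates reduce to coordinates. The Euclidean norm
    enters only at the two ends, at the cost of a factor depending on [d]. *)

Section Calculus.
Context {R : realType} {d : nat}.
Implicit Types (f : 'rV[R]_d -> R) (v w x y : 'rV[R]_d).

Lemma ler_coord v i : `|v 0 i| <= `|v|.
Proof.
rewrite [leRHS]/Num.Def.normr /= mx_normrE.
exact: (le_bigmax _ (fun ij : 'I_1 * 'I_d => `|v ij.1 ij.2|) (0, i)).
Qed.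

Lemma norm_rV_le v (c : R) : 0 <= c -> (forall i, `|v 0 i| <= c) -> `|v| <= c.
Proof.
move=> c0 vc; rewrite [leLHS]/Num.Def.normr /= mx_normrE.
by apply: bigmax_le => // -[i j] _ /=; rewrite (ord1 i).
Qed.

Lemma is_derive_coord (g : R -> 'rV[R]_d) (t : R) (dg : 'rV[R]_d) i :
  is_derive t 1 g dg -> is_derive t 1 (fun s => g s 0 i) (dg 0 i).
Proof.
move=> [Dg <-]; apply: DeriveDef; first by move/derivable_mxP : Dg; exact.
by rewrite derive_mx // mxE.
Qed.

Lemma is_derive_row (g : R -> 'rV[R]_d) (t : R) (dg : 'rV[R]_d) :
  (forall i, is_derive t 1 (fun s => g s 0 i) (dg 0 i)) -> is_derive t 1 g dg.
Proof.
move=> H; have Dg : derivable g t 1.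
  by apply/derivable_mxP => i j; rewrite (ord1 i); case: (H j).
apply: DeriveDef => //; rewrite derive_mx //; apply/rowP => i.
by rewrite mxE; case: (H i).
Qed.

Lemma continuous_within_coord (g : R -> 'rV[R]_d) (A : set R) i :
  {within A, continuous g} -> {within A, continuous (fun s => g s 0 i)}.
Proof.
move=> /subspace_continuousP cg; apply/subspace_continuousP => t At.
have := cvg_comp _ _ (cg t At) (@coord_continuous _ _ _ 0 i (g t)); exact.
Qed.

(** In the sup norm the scalar mean value theorem can be applied to each coordinate separately; the
    intermediate points need not agree. *)
Lemma mean_value_rV (g dg : R -> 'rV[R]_d) (a b c : R) : a <= b ->
  {within `[a, b], continuous g} ->
  (forall t, a < t < b -> is_derive t 1 g (dg t)) ->
  (forall t, a < t < b -> `|dg t| <= c) ->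
  `|g b - g a| <= c * (b - a).
Proof.
rewrite le_eqVlt => /predU1P[-> _ _ _|ab cg Dg dgc].
  by rewrite !subrr normr0 mulr0.
have c0 : 0 <= c.
  have mid : a < (a + b) / 2 < b by rewrite !midf_lt.
  exact: le_trans (normr_ge0 _) (dgc _ mid).
apply: norm_rV_le => [|i]; first by rewrite mulr_ge0 // subr_ge0 ltW.
rewrite !mxE.
have [||t] := @MVT R (fun s => g s 0 i) (fun s => dg s 0 i) a b ab.
- by move=> t /[!in_itv] /= tab; exact/is_derive_coord/Dg.
- exact: continuous_within_coord.
rewrite in_itv /= => tab ->.
rewrite normrM (gtr0_norm (x := b - a)) ?subr_gt0 // ler_pM2r ?subr_gt0 //.
exact: le_trans (ler_coord _ _) (dgc _ tab).
Qed.

(* The exit time from the ball would contradict the speed bound. *)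
Lemma speed_bound (g dg : R -> 'rV[R]_d) w0 (T B rho : R) :
  {within `[0, T], continuous g} -> g 0 = w0 ->
  (forall t, 0 < t < T -> is_derive t 1 g (dg t)) ->
  (forall t, 0 < t < T -> `|g t - w0| < rho -> `|dg t| <= B) ->
  0 <= B -> B * T < rho -> 0 < rho ->
  forall t, 0 <= t <= T -> `|g t - w0| <= B * t.
Proof.
move=> cg g0 Dg dgB B0 BT rho0.
have sub (s t : R) : t <= T -> s <= t -> {within `[0, s], continuous g}.
  move=> tT st; apply: continuous_subspaceW cg => u /=; rewrite !in_itv /=.
  by move=> /andP[-> us]; exact: le_trans us (le_trans st tT).
suff inball t : 0 <= t <= T -> `|g t - w0| < rho.
  move=> t /andP[t0 tT]; rewrite -g0 -[t in B * t]subr0.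
  apply: (@mean_value_rV _ dg) => //; first exact: sub tT _.
  - by move=> s /andP[s0 st]; apply: Dg; rewrite s0 (lt_le_trans st).
  - move=> s /andP[s0 st]; have sT := lt_le_trans st tT.
    by apply: dgB; [rewrite s0|apply: inball; rewrite !ltW].
move=> /andP[t0 tT]; rewrite ltNge; apply/negP => tS.
pose S := [set s : R | 0 <= s <= T /\ rho <= `|g s - w0|].
have Sinf : has_inf S.
  split; first by exists t; split=> //; rewrite t0.
  by exists 0 => s [/andP[]].
pose tau := inf S.
have tau0 : 0 <= tau.
  apply: lb_le_inf; [exact: Sinf.1|by move=> s [/andP[]]].
have taule s : S s -> tau <= s by move=> Ss; apply: ge_inf => //; exact: Sinf.2.
have tauT : tau <= T.
  by apply: (le_trans _ tT); apply: taule; split=> //; rewrite t0.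
have before s : 0 <= s < tau -> `|g s - w0| < rho.
  move=> /andP[s0 stau]; rewrite ltNge; apply/negP => sS.
  suff : tau <= s by rewrite leNgt stau.
  by apply: taule; split=> //; rewrite s0 (le_trans (ltW stau)).
(* Before [tau] the path is in the ball, so the speed bound still places it strictly inside at
   [tau]. By continuity it stays inside near [tau], whereas [S] has points arbitrarily close to its
   infimum. *)
have gtau : `|g tau - w0| < rho.
  apply: (le_lt_trans _ BT); apply: (@le_trans _ _ (B * (tau - 0))); last first.
    by rewrite subr0 ler_wpM2l.
  rewrite -g0; apply: (@mean_value_rV _ dg) => //; first exact: sub tauT _.
  - by move=> s /andP[s0 st]; apply: Dg; rewrite s0 (lt_le_trans st).
  - move=> s /andP[s0 st]; have sT := lt_le_trans st tauT.
    by apply: dgB; [rewrite s0|apply: before; rewrite st ltW].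
have /subspace_continuousP/(_ tau) := cg.
rewrite /= in_itv /= tau0 tauT => /(_ isT)/cvgrPdist_lt.
move=> /(_ (rho - `|g tau - w0|)).
rewrite subr_gt0 => /(_ gtau); rewrite /prop_near1 /within /=.
move=> /nbhs_ballP[e /= e0 He].
have [s [/andP[s0 sT] sS] stau] := inf_adherent e0 Sinf.
have ts := taule s (conj (introT andP (conj s0 sT)) sS).
have : `|g tau - g s| < rho - `|g tau - w0|.
  apply: He; last by rewrite in_itv /= s0 sT.
  by rewrite /ball /= ler0_norm; lra.
rewrite ltrBrDr => H; suff : `|g s - w0| < rho by rewrite ltNge sS.
apply: le_lt_trans H.
by rewrite -(subrKA (g tau)) (le_trans (ler_normD _ _)) // distrC.
Qed.

End Calculus.

(** * Mean values and mixed partial derivatives *)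

Section Partials.
Context {R : realType} {d : nat}.
Implicit Types (f g : 'rV[R]_d -> R) (u v w x y : 'rV[R]_d).
Local Notation e_ i := (delta_mx 0 i : 'rV[R]_d).

Lemma is_derive_line f x v (t : R) :
  (forall w, differentiable f w) ->
  is_derive t (1 : R) (fun s : R => f (x + s *: v)) ('D_v f (x + t *: v)).
Proof.
move=> df.
have quot : (fun h : R => h^-1 *:
    (((fun s : R => f (x + s *: v)) \o shift t) (h *: 1) - f (x + t *: v))) =
  (fun h : R => h^-1 *: ((f \o shift (x + t *: v)) (h *: v) - f (x + t *: v))).
  apply/funext => h /=; congr (_ *: (f _ - _)).
  by rewrite [h *: 1]mulr1 scalerDl addrCA.
apply: DeriveDef; last by rewrite /derive quot.
by rewrite /derivable quot; exact: diff_derivable.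
Qed.

Lemma derive_partials f x v : differentiable f x ->
  'D_v f x = \sum_(i < d) v 0 i * partial i f x.
Proof.
move=> df; rewrite deriveE // [in LHS](row_sum_delta v) linear_sum.
by apply: eq_bigr => i _; rewrite linearZ /partial deriveE.
Qed.

Lemma mean_value_dir f x v : (forall w, differentiable f w) ->
  exists2 t : R, 0 <= t <= 1 & f (x + v) - f x = 'D_v f (x + t *: v).
Proof.
move=> df.
have [|||t] := @MVT_segment R (fun s : R => f (x + s *: v))
  (fun s : R => 'D_v f (x + s *: v)) 0 1.
- exact: ler01.
- by move=> s _; exact: is_derive_line.
- apply: derivable_within_continuous => s _.
  by case: (is_derive_line x v s df).
rewrite in_itv /= scale1r scale0r addr0 subr0 mulr1 => t01 ->.
by exists t.
Qed.

Lemma lipschitz_of_partials f (A : set 'rV[R]_d) (M : R) x y :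
  (forall w, differentiable f w) -> 0 <= M ->
  (forall t : R, 0 <= t <= 1 -> A (x + t *: (y - x))) ->
  (forall i w, A w -> `|partial i f w| <= M) ->
  `|f y - f x| <= d%:R * M * `|y - x|.
Proof.
move=> df M0 Axy fM; have [t t01] := mean_value_dir x (y - x) df.
rewrite subrKC => ->; rewrite derive_partials //.
apply: le_trans (ler_norm_sum _ _ _) _.
rewrite -mulrA mulr_natl -[X in _ *+ X]card_ord -sumr_const ler_sum // => i _.
by rewrite normrM mulrC ler_pM // ?ler_coord // fM //; exact: Axy.
Qed.

Definition segment_closed (A : set 'rV[R]_d) :=
  forall x y (t : R), A x -> A y -> 0 <= t <= 1 -> A (x + t *: (y - x)).

(** A mean value along the segment, then a Lipschitz bound for each partial between [x] and the
    intermediate point. Each of the two steps costs a factor [d]; the usual 1/2 is given up, as only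
    the order in [y - x] matters. *)
Lemma taylor1 f (A : set 'rV[R]_d) (M : R) x y : segment_closed A ->
  (forall w, differentiable f w) ->
  (forall i w, differentiable (partial i f) w) -> 0 <= M ->
  (forall i j w, A w -> `|partial j (partial i f) w| <= M) ->
  A x -> A y ->
  `|f y - f x - \sum_(i < d) (y - x) 0 i * partial i f x|
    <= d%:R ^+ 2 * M * `|y - x| ^+ 2.
Proof.
move=> segA df ddf M0 fM Ax Ay; have [t t01] := mean_value_dir x (y - x) df.
rewrite subrKC => ->; rewrite derive_partials // -sumrB.
apply: le_trans (ler_norm_sum _ _ _) _.
have -> : d%:R ^+ 2 * M * `|y - x| ^+ 2
    = \sum_(i < d) `|y - x| * (d%:R * M * `|y - x|).
  by rewrite sumr_const card_ord -mulr_natl; ring.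
apply: ler_sum => i _; rewrite -mulrBr normrM ler_pM // ?ler_coord //.
have At : A (x + t *: (y - x)) by exact: segA.
apply: (@le_trans _ _ (d%:R * M * `|x + t *: (y - x) - x|)).
  apply: (@lipschitz_of_partials _ A) => // [s s01|j w Aw]; last exact: fM.
  exact: segA.
rewrite addrAC subrr add0r normrZ ler_wpM2l ?mulr_ge0 //.
by case/andP: t01 => t0 t1; rewrite ger0_norm // ler_piMl.
Qed.

Lemma mean_value_partial f x i (s : R) : (forall w, differentiable f w) ->
  exists2 t : R, `|t| <= `|s| &
    f (x + s *: e_ i) - f x = s * partial i f (x + t *: e_ i).
Proof.
move=> df; have [t /andP[t0 t1] ->] := mean_value_dir x (s *: e_ i) df.
exists (t * s); first by rewrite normrM ger0_norm // ler_piMl.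
by rewrite deriveE // linearZ /= -deriveE // scalerA.
Qed.

Lemma differentiable_shift f u : (forall w, differentiable f w) ->
  forall w, differentiable (fun x => f (x + u)) w.
Proof.
move=> df w; have -> : (fun x => f (x + u)) = f \o (id \+ cst u) by [].
exact: differentiable_comp.
Qed.

Lemma partial_shift f u i w :
  partial i (fun x => f (x + u)) w = partial i f (w + u).
Proof.
rewrite /partial /derive /=.
by under [in LHS]eq_fun do rewrite -addrA.
Qed.

Lemma partialB f g i w : differentiable f w -> differentiable g w ->
  partial i (fun x => f x - g x) w = partial i f w - partial i g w.
Proof. by move=> df dg; rewrite /partial deriveB //; exact: diff_derivable. Qed.

(** Two nested mean values: along [e_ i] for the increment [g] of [f] in direction [e_ j], then
    along [e_ j] for [partial i f]. The second difference is symmetric in [i] and [j], so exchanging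
    them yields the other mixed partial. *)
Lemma second_difference f i j w (s : R) : s != 0 ->
  (forall w, differentiable f w) ->
  (forall i w, differentiable (partial i f) w) ->
  exists u, `|u - w| <= 2 * `|s| /\
   f (w + s *: e_ i + s *: e_ j) - f (w + s *: e_ i) - f (w + s *: e_ j) + f w
     = s ^+ 2 * partial j (partial i f) u.
Proof.
move=> s0 df ddf; pose g x := f (x + s *: e_ j) - f x.
have dg x : differentiable g x.
  by apply: differentiableB => //; exact: differentiable_shift.
have [t ts tE] := mean_value_partial w i s dg.
have [t' ts' t'E] := mean_value_partial (w + t *: e_ i) j s (ddf i).
exists (w + t *: e_ i + t' *: e_ j); split.
  rewrite -[w + _ + _]addrA [w + _]addrC addrK.
  apply: le_trans (ler_normD _ _) _.
  have e1 k : `|e_ k| <= 1.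
    by apply: norm_rV_le => // l; rewrite mxE normr_nat lern1 leq_b1.
  rewrite !normrZ mulr2n mulrDl mul1r lerD //.
    exact: le_trans (ler_piMr (normr_ge0 _) (e1 _)) ts.
  exact: le_trans (ler_piMr (normr_ge0 _) (e1 _)) ts'.
transitivity (g (w + s *: e_ i) - g w); first by rewrite /g; ring.
rewrite tE /g partialB //; last exact: differentiable_shift.
by rewrite partial_shift t'E; ring.
Qed.

(** Two points are allowed because the two orders of differentiation produce unrelated intermediate
    points, both tending to [w] with [s]. *)
Lemma eq_limits (P Q : 'rV[R]_d -> R) w : {for w, continuous P} ->
  {for w, continuous Q} ->
  (forall s : R, s != 0 -> exists u u',
     [/\ `|u - w| <= 2 * `|s|, `|u' - w| <= 2 * `|s| & P u = Q u']) ->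
  P w = Q w.
Proof.
move=> cP cQ PQ; apply/eqP; rewrite -subr_eq0 -normr_le0.
apply/ler_addgt0Pr => e e0; rewrite add0r.
have near_w (F : 'rV[R]_d -> R) : {for w, continuous F} -> exists2 r, 0 < r &
    forall u, `|u - w| < r -> `|F w - F u| < e / 2.
  move=> cF; have e20 : 0 < e / 2 by rewrite divr_gt0.
  have /cvgrPdist_lt/(_ _ e20)/nbhs_ballP[r /= r0 H] := cF.
  by exists r => // u ur; apply: H; rewrite -ball_normE /= distrC.
have [r1 r10 H1] := near_w P cP; have [r2 r20 H2] := near_w Q cQ.
have [s [s0 sr1 sr2]] : exists s : R, [/\ 0 < s, 2 * `|s| < r1 & 2 * `|s| < r2].
  have r0 : 0 < Num.min r1 r2 by rewrite lt_min r10.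
  have rr1 : Num.min r1 r2 <= r1 by rewrite ge_min lexx.
  have rr2 : Num.min r1 r2 <= r2 by rewrite ge_min lexx orbT.
  have s0 : 0 < Num.min r1 r2 / 4 by rewrite divr_gt0.
  by exists (Num.min r1 r2 / 4); split=> //; rewrite gtr0_norm //; lra.
have [u [u' [uw uw' uu']]] := PQ s (lt0r_neq0 s0).
have close1 := H1 u (le_lt_trans uw sr1).
have close2 := H2 u' (le_lt_trans uw' sr2).
rewrite -(subrKA (P u)) {2}uu' [e]splitr.
apply: (le_trans (ler_normD _ _)); apply: lerD; first exact: ltW.
by rewrite distrC; exact: ltW.
Qed.

(* Both mixed partials are limits of the same second difference quotient. *)
Lemma schwarz f i j w :
  (forall w, differentiable f w) ->
  (forall i w, differentiable (partial i f) w) ->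
  (forall i j, continuous (partial i (partial j f))) ->
  partial i (partial j f) w = partial j (partial i f) w.
Proof.
move=> df ddf cf; apply: (eq_limits (cf i j w) (cf j i w)) => s s0.
have [u [uw uE]] := second_difference j i w s0 df ddf.
have [u' [uw' uE']] := second_difference i j w s0 df ddf.
have s2 : s ^+ 2 != 0 by rewrite expf_neq0.
exists u, u'; split; [exact: uw|exact: uw'|apply: (mulfI s2)].
apply: (etrans (esym uE) (etrans _ uE')).
by rewrite [w + s *: e_ j + _]addrAC; congr (_ + f w); exact: addrAC.
Qed.

End Partials.

(** * Bounds on gradients and Hessians *)

Section Smooth.
Context {R : realType} {d : nat}.
Implicit Types (f g : 'rV[R]_d -> R) (u v w x y : 'rV[R]_d) (A : set 'rV[R]_d).
Implicit Types (F G : 'rV[R]_d -> 'rV[R]_d).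

Lemma CkW n f : Ck n.+1 f -> Ck n f.
Proof.
elim: n f => [|n IH] f [df cf]; first by move=> w; exact: differentiable_continuous.
by split=> // i; exact/IH/cf.
Qed.

Lemma continuous_lincomb (c : R) n (F : 'I_n -> 'rV[R]_d -> R) :
  (forall k, continuous (F k)) ->
  continuous (fun w => c * \sum_(k < n) F k w).
Proof.
move=> cF w.
apply: (@continuousM _ _ (cst c) (fun w => \sum_(k < n) F k w)).
  exact: cst_continuous.
have -> : (fun w => \sum_(k < n) F k w) = \sum_(k < n) F k.
  by apply/funext => u; rewrite fct_sumE.
suff : continuous (\sum_(k < n) F k) by exact.
elim/big_ind : _ => [|f g cf cg|k _]; first exact: cst_continuous.
  by move=> u; apply: continuousD; [exact: cf|exact: cg].
exact: cF.
Qed.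

Lemma differentiable_lincomb (c : R) n (F : 'I_n -> 'rV[R]_d -> R) w :
  (forall k, differentiable (F k) w) ->
  differentiable (fun w => c * \sum_(k < n) F k w) w.
Proof.
move=> dF; have -> : (fun w => c * \sum_(k < n) F k w) = c *: \sum_(k < n) F k.
  by apply/funext => u; rewrite fctE fct_sumE.
exact/differentiableZ/differentiable_sum.
Qed.

Lemma partial_lincomb (c : R) n (F : 'I_n -> 'rV[R]_d -> R) i :
  (forall k w, differentiable (F k) w) ->
  partial i (fun w => c * \sum_(k < n) F k w) =
  (fun w => c * \sum_(k < n) partial i (F k) w).
Proof.
move=> dF; apply/funext => w; rewrite /partial.
have -> : (fun w => c * \sum_(k < n) F k w) = c *: \sum_(k < n) F k.
  by apply/funext => u; rewrite fctE fct_sumE.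
rewrite deriveZ; last by apply: derivable_sum => k; exact: diff_derivable.
by rewrite derive_sum // => k; exact: diff_derivable.
Qed.

Lemma Ck_lincomb p (c : R) n (F : 'I_n -> 'rV[R]_d -> R) :
  (forall k, Ck p (F k)) -> Ck p (fun w => c * \sum_(k < n) F k w).
Proof.
elim: p F => [|p IH] F CF; first exact: continuous_lincomb.
have dF k w : differentiable (F k) w by case: (CF k).
split=> [w|i]; first exact: differentiable_lincomb.
by rewrite partial_lincomb //; apply: IH => k; case: (CF k) => _; exact.
Qed.

Lemma normr_mean_fin (V : normedModType R) (T : finType) (v : T -> V) (c : R) :
  (0 < #|T|)%N -> (forall k, `|v k| <= c) -> `|#|T|%:R^-1 *: \sum_k v k| <= c.
Proof.
move=> n0 vc; rewrite normrZ normfV normr_nat ler_pdivrMl ?ltr0n //.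
apply: le_trans (ler_norm_sum _ _ _) _.
by rewrite mulr_natl -sumr_const ler_sum.
Qed.

Lemma normr_mean (V : normedModType R) n (v : 'I_n -> V) (c : R) : (0 < n)%N ->
  (forall k, `|v k| <= c) -> `|n%:R^-1 *: \sum_(k < n) v k| <= c.
Proof. by move=> n0 vc; have := @normr_mean_fin _ 'I_n v c; rewrite card_ord; exact. Qed.

Lemma partials_bounded_mean p A (M : R) n (F : 'I_n -> 'rV[R]_d -> R) :
  (0 < n)%N -> (forall k, Ck p (F k)) ->
  (forall k, partials_bounded p A M (F k)) ->
  partials_bounded p A M (fun w => n%:R^-1 * \sum_(k < n) F k w).
Proof.
elim: p F => [//|p IH] F n0 CF bF i.
rewrite partial_lincomb; last by move=> k w; case: (CF k).
split=> [w Aw|]; last by apply: IH => // k; [case: (CF k) => _; exact|case: (bF k i)].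
by apply: (@normr_mean R^o) => // k; case: (bF k i) => + _; exact.
Qed.

(** The row index is the direction of differentiation, so that [v *m hess f w] is the derivative of
    [grad f] along the row vector [v]. *)
Definition hess f w : 'M[R]_d := \matrix_(l, i) partial l (partial i f) w.

Lemma grad_lincomb (c : R) n (F : 'I_n -> 'rV[R]_d -> R) w :
  (forall k w, differentiable (F k) w) ->
  grad (fun w => c * \sum_(k < n) F k w) w = c *: \sum_(k < n) grad (F k) w.
Proof.
move=> dF; apply/rowP => i; rewrite !mxE partial_lincomb // summxE.
by congr (_ * _); apply: eq_bigr => k _; rewrite mxE.
Qed.

Lemma hess_lincomb (c : R) n (F : 'I_n -> 'rV[R]_d -> R) w :
  (forall k, Ck 2 (F k)) ->
  hess (fun w => c * \sum_(k < n) F k w) w = c *: \sum_(k < n) hess (F k) w.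
Proof.
move=> CF; apply/matrixP => l i; rewrite !mxE partial_lincomb; last first.
  by move=> k u; case: (CF k).
rewrite partial_lincomb; last by move=> k u; case: (CF k) => _ /(_ i)[].
by rewrite summxE; congr (_ * _); apply: eq_bigr => k _; rewrite mxE.
Qed.

(* The last clause makes [J x] the derivative of [F] at [x], acting on the right. *)
Definition field_bounds A (K : R) F (J : 'rV[R]_d -> 'M[R]_d) :=
  [/\ forall x, A x -> `|F x| <= K,
      forall x y, A x -> A y -> `|F y - F x| <= K * `|y - x|,
      forall x v, A x -> `|v *m J x| <= K * `|v| &
      forall x y, A x -> A y ->
        `|F y - F x - (y - x) *m J x| <= K * `|y - x| ^+ 2].

(** One constant dominating [M], [d * M] and [d^2 * M], the sizes of the four estimates in
    [field_bounds]; the successor covers [d = 0]. *)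
Definition jet_bound (M : R) : R := d.+1%:R ^+ 2 * M.

Lemma jet_bound_ge (M : R) : 0 <= M ->
  [/\ M <= jet_bound M, d%:R * M <= jet_bound M & d%:R ^+ 2 * M <= jet_bound M].
Proof.
move=> M0; rewrite /jet_bound; split.
- by rewrite ler_peMl // -natrX ler1n expn_gt0.
- by rewrite ler_wpM2r // -natrX ler_nat (leq_trans (leqnSn d)) // leq_pmulr.
- by rewrite ler_wpM2r // -!natrX ler_nat leq_exp2r.
Qed.

Lemma norm_mulmx_le v (J : 'M[R]_d) (M : R) : 0 <= M ->
  (forall l i, `|J l i| <= M) -> `|v *m J| <= d%:R * M * `|v|.
Proof.
move=> M0 JM; apply: norm_rV_le => [|i]; first by rewrite !mulr_ge0.
rewrite mxE; apply: le_trans (ler_norm_sum _ _ _) _.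
rewrite -mulrA mulr_natl -[X in _ *+ X]card_ord -sumr_const ler_sum // => l _.
by rewrite normrM mulrC ler_pM // ler_coord.
Qed.

Lemma grad_bounds A (M : R) f : segment_closed A -> 0 <= M -> Ck 3 f ->
  partials_bounded 3 A M f -> field_bounds A (jet_bound M) (grad f) (hess f).
Proof.
move=> segA M0 [df Cf] bf; have [K1 K2 K3] := jet_bound_ge M0.
have K0 : 0 <= jet_bound M by exact: le_trans K1.
split.
- move=> x Ax; apply: norm_rV_le => // i; rewrite mxE.
  by apply: le_trans K1; case: (bf i) => + _; exact.
- move=> x y Ax Ay; apply: norm_rV_le => [|i]; first by rewrite mulr_ge0.
  rewrite !mxE.
  apply: (@le_trans _ _ (d%:R * M * `|y - x|)); last by rewrite ler_wpM2r.
  apply: (@lipschitz_of_partials _ _ _ A) => //.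
  + by case: (Cf i).
  + by move=> t t01; exact: segA.
  + by move=> l w Aw; case: (bf i) => _ /(_ l)[+ _]; exact.
- move=> x v Ax.
  apply: (@le_trans _ _ (d%:R * M * `|v|)); last by rewrite ler_wpM2r.
  apply: norm_mulmx_le => // l i; rewrite mxE.
  by case: (bf i) => _ /(_ l)[+ _]; exact.
- move=> x y Ax Ay; apply: norm_rV_le => [|i]; first by rewrite mulr_ge0.
  apply: (@le_trans _ _ (d%:R ^+ 2 * M * `|y - x| ^+ 2)); last first.
    by rewrite ler_wpM2r.
  rewrite !mxE; under eq_bigr do rewrite [hess _ _ _ _]mxE.
  apply: (@taylor1 _ _ _ A) => //.
  + by case: (Cf i).
  + by move=> l w; case: (Cf i) => _ /(_ l)[].
  + by move=> l l' w Aw; case: (bf i) => _ /(_ l)[_] /(_ l')[+ _]; exact.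
Qed.

(** The acceleration along the gradient flow of [f] and, by symmetry of the Hessian, half the
    gradient of the squared gradient norm. This double reading is what turns [h^2] terms into a
    correction of the loss. *)
Definition self_force f w : 'rV[R]_d := grad f w *m hess f w.

Lemma self_forceE f w i :
  self_force f w 0 i = \sum_l partial l f w * partial l (partial i f) w.
Proof. by rewrite mxE; apply: eq_bigr => l _; rewrite !mxE. Qed.

(** The increment of the product is split into one increment of the gradient and one of the Hessian,
    the latter controlled by third partials. The drift is built from self-forces, so this makes the
    modified field Lipschitz. *)
Lemma self_force_bounds A (M : R) f : segment_closed A -> 0 <= M -> Ck 3 f ->
  partials_bounded 3 A M f ->
  (forall x, A x -> `|self_force f x| <= 2 * (jet_bound M) ^+ 2) /\
  (forall x y, A x -> A y ->
     `|self_force f y - self_force f x| <= 2 * (jet_bound M) ^+ 2 * `|y - x|).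
Proof.
move=> segA M0 Cf bf; have [K1 K2 K3] := jet_bound_ge M0.
have [B1 B2 B3 B4] := grad_bounds segA M0 Cf bf.
set K := jet_bound M in K1 K2 K3 B1 B2 B3 B4 *.
have K0 : 0 <= K by exact: le_trans K1.
have l2 l i x y : A x -> A y ->
    `|partial l (partial i f) y - partial l (partial i f) x| <= d%:R * M * `|y - x|.
  move=> Ax Ay; case: Cf => df /(_ i)[ddf /(_ l)[d3f _]].
  apply: (@lipschitz_of_partials _ _ _ A) => // [t t01|k w Aw]; first exact: segA.
  by case: (bf i) => _ /(_ l)[_] /(_ k)[+ _]; exact.
split=> [x Ax|x y Ax Ay].
  apply: (le_trans (B3 _ _ Ax)).
  by rewrite expr2 mulrA ler_pM // ?B1 // mulr_natl mulr2n lerDl.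
rewrite /self_force -(subrKA (grad f x *m hess f y)) -mulmxBl -mulmxBr.
apply: le_trans (ler_normD _ _) _.
have -> : 2 * K ^+ 2 * `|y - x| = K * (K * `|y - x|) + K * `|y - x| * K by ring.
apply: lerD; first by apply: (le_trans (B3 _ _ Ay)); rewrite ler_wpM2l // B2.
apply: le_trans (@norm_mulmx_le _ _ (d%:R * M * `|y - x|) _ _) _.
- by rewrite !mulr_ge0.
- by move=> l i; rewrite !mxE; exact: l2.
apply: ler_pM; rewrite ?mulr_ge0 ?B1 //.
by rewrite !mulrA -expr2 ler_wpM2r.
Qed.

End Smooth.

(** * The gradient of the modified loss *)

Section ModifiedLoss.
Context {R : realType} {d : nat}.
Implicit Types (f g : 'rV[R]_d -> R) (u v w x y : 'rV[R]_d).

Definition gradsq f w : R := \sum_(l < d) partial l f w ^+ 2.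

Lemma enorm_sqr v : enorm v ^+ 2 = \sum_(i < d) v 0 i ^+ 2.
Proof. by rewrite /enorm sqr_sqrtr // sumr_ge0 // => i _; exact: sqr_ge0. Qed.

Lemma enorm_grad_sqr f w : enorm (grad f w) ^+ 2 = gradsq f w.
Proof. by rewrite enorm_sqr; apply: eq_bigr => i _; rewrite mxE. Qed.

Lemma gradsq_differentiable f w : Ck 2 f -> differentiable (gradsq f) w.
Proof.
move=> [df Cf].
have -> : gradsq f = (fun w => 1 * \sum_(l < d) (partial l f * partial l f) w).
  by apply/funext => u; rewrite mul1r; apply: eq_bigr => l _; rewrite expr2.
apply: differentiable_lincomb => l.
by case: (Cf l) => ddf _; exact: differentiableM.
Qed.

Lemma partial_gradsq f i w : Ck 2 f ->
  partial i (gradsq f) w = 2 * self_force f w 0 i.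
Proof.
move=> [df Cf]; have ddf l : forall u, differentiable (partial l f) u.
  by case: (Cf l).
have -> : gradsq f = (fun w => 1 * \sum_(l < d) (partial l f * partial l f) w).
  by apply/funext => u; rewrite mul1r; apply: eq_bigr => l _; rewrite expr2.
rewrite partial_lincomb; last by move=> l u; exact: differentiableM.
rewrite mul1r self_forceE mulr_sumr; apply: eq_bigr => l _.
rewrite {1}/partial deriveM; [|exact: diff_derivable..].
rewrite -/(partial i (partial l f) w) schwarz //.
  by rewrite /GRing.scale /=; ring.
by move=> k k'; case: (Cf k') => _; exact.
Qed.

Lemma grad_gradsq f w : Ck 2 f -> grad (gradsq f) w = 2 *: self_force f w.
Proof. by move=> Cf; apply/rowP => i; rewrite !mxE partial_gradsq // mxE. Qed.

Lemma Ck_gradsq f : Ck 2 f -> Ck 1 (gradsq f).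
Proof.
move=> Cf; split=> [w|i]; first exact: gradsq_differentiable.
have -> : partial i (gradsq f) =
    (fun w => 2 * \sum_(l < d) (partial l f * partial l (partial i f)) w).
  by apply/funext => w; rewrite partial_gradsq // self_forceE.
apply: continuous_lincomb => l w.
case: Cf => _ Cf; apply: continuousM; last by case: (Cf i) => _; exact.
by case: (Cf l) => ddf _; exact: differentiable_continuous.
Qed.

Lemma CkB1 f g : Ck 1 f -> Ck 1 g -> Ck 1 (fun w => f w - g w).
Proof.
move=> [df cf] [dg cg]; split=> [w|i]; first exact: differentiableB.
have -> : partial i (fun w => f w - g w) = (fun w => partial i f w - partial i g w).
  by apply/funext => w; rewrite partialB.
by move=> w; apply: continuousB; [exact: cf|exact: cg].
Qed.

Lemma gradB f g w : differentiable f w -> differentiable g w ->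
  grad (fun w => f w - g w) w = grad f w - grad g w.
Proof. by move=> df dg; apply/rowP => i; rewrite !mxE partialB. Qed.

Lemma grad_addZ f g (a : R) w : differentiable f w -> differentiable g w ->
  grad (fun w => f w + a * g w) w = grad f w + a *: grad g w.
Proof.
move=> df dg; apply/rowP => i; rewrite !mxE /partial.
have -> : (fun w => f w + a * g w) = f + a *: g by [].
rewrite deriveD; [|exact: diff_derivable|].
  by rewrite deriveZ //; exact: diff_derivable.
exact/derivableZ/diff_derivable.
Qed.

End ModifiedLoss.

(** * The FedAvg correction as a combination of squared gradient norms *)

Section FedAvgLoss.
Context {R : realType} {d m E : nat}.
Variable L : 'I_m -> 'I_E -> 'rV[R]_d -> R.
Hypotheses (m0 : (0 < m)%N) (E0 : (0 < E)%N) (CL : forall j k, Ck 3 (L j k)).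
Implicit Types w : 'rV[R]_d.

Lemma Ck_client j : Ck 3 (client_loss L j).
Proof. exact: Ck_lincomb. Qed.

Lemma Ck_global : Ck 3 (global_loss L).
Proof. apply: Ck_lincomb; exact: Ck_client. Qed.

Lemma partials_bounded_client (A : set 'rV[R]_d) (M : R) j :
  (forall j k, partials_bounded 3 A M (L j k)) ->
  partials_bounded 3 A M (client_loss L j).
Proof. by move=> bL; exact: partials_bounded_mean. Qed.

Lemma partials_bounded_global (A : set 'rV[R]_d) (M : R) :
  (forall j k, partials_bounded 3 A M (L j k)) ->
  partials_bounded 3 A M (global_loss L).
Proof.
move=> bL; apply: partials_bounded_mean => // j; first exact: Ck_client.
exact: partials_bounded_client.
Qed.

Lemma grad_global w :
  grad (global_loss L) w = m%:R^-1 *: \sum_(j < m) grad (client_loss L j) w.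
Proof. by rewrite grad_lincomb // => j u; case: (Ck_client j). Qed.

(* The one-term sum and the nested sum let [grad_lincomb] apply to all terms. *)
Definition loss_correction w : R :=
  (E%:R / 4) * \sum_(k < 1) gradsq (global_loss L) w -
  ((E%:R / (4 * m%:R)) * \sum_(j < m) gradsq (client_loss L j) w -
   (4 * m%:R * E%:R)^-1 * \sum_(j < m) 1 * \sum_(k < E) gradsq (L j k) w).

(* The gradient of [loss_correction] divided by [E], so that its bounds do not
   depend on [E]. *)
Definition drift w : 'rV[R]_d :=
  2^-1 *: (self_force (global_loss L) w -
   (m%:R^-1 *: \sum_(j < m) self_force (client_loss L j) w -
    E%:R^-1 *: (m%:R^-1 *: \sum_(j < m)
      (E%:R^-1 *: \sum_(k < E) self_force (L j k) w)))).

Let mR : m%:R != 0 :> R. Proof. by rewrite pnatr_eq0 -lt0n. Qed.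
Let ER : E%:R != 0 :> R. Proof. by rewrite pnatr_eq0 -lt0n. Qed.

Let CL2 j k : Ck 2 (L j k). Proof. exact/CkW. Qed.
Let Cj2 j : Ck 2 (client_loss L j). Proof. exact/CkW/Ck_client. Qed.
Let Cg2 : Ck 2 (global_loss L). Proof. exact/CkW/Ck_global. Qed.

Lemma Ck_loss_correction : Ck 1 loss_correction.
Proof.
apply: CkB1.
  by apply: Ck_lincomb => k; exact: (Ck_gradsq Cg2).
apply: CkB1.
  by apply: Ck_lincomb => j; exact: (Ck_gradsq (Cj2 j)).
apply: Ck_lincomb => j; apply: Ck_lincomb => k.
exact: (Ck_gradsq (CL2 j k)).
Qed.

Lemma grad_loss_correction w : grad loss_correction w = E%:R *: drift w.
Proof.
have dlc (c : R) n (F : 'I_n -> 'rV[R]_d -> R) u : (forall k, Ck 1 (F k)) ->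
    differentiable (fun w => c * \sum_(k < n) F k w) u.
  by move=> CF; apply: differentiable_lincomb => k; case: (CF k).
have C1g := Ck_gradsq Cg2; have C1j j := Ck_gradsq (Cj2 j).
have C1L j k := Ck_gradsq (CL2 j k).
have C1s j := Ck_lincomb 1 (C1L j).
have dg u := gradsq_differentiable u Cg2.
have dj j u := gradsq_differentiable u (Cj2 j).
have dL j k u := gradsq_differentiable u (CL2 j k).
have ds j u := dlc 1 _ _ u (C1L j).
have d1 u := dlc (E%:R / 4) 1%N _ u (fun=> C1g).
have d2 u := dlc (E%:R / (4 * m%:R)) _ _ u C1j.
have d3 u := dlc (4 * m%:R * E%:R)^-1 _ _ u C1s.
rewrite /loss_correction (gradB (d1 w) (differentiableB (d2 w) (d3 w))).
rewrite (gradB (d2 w) (d3 w)).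
rewrite (grad_lincomb _ _ (fun=> dg)) (grad_lincomb _ _ dj) (grad_lincomb _ _ ds).
rewrite big_ord1 (grad_gradsq _ Cg2).
under eq_bigr do rewrite (grad_gradsq _ (Cj2 _)).
under [X in _ - (_ - _ *: X)]eq_bigr => j _.
  rewrite (grad_lincomb _ _ (dL j)).
  under eq_bigr do rewrite (grad_gradsq _ (CL2 _ _)).
  over.
rewrite /drift; apply/rowP => i; rewrite !(mxE, summxE).
have e1 : \sum_(j < m) (2 *: self_force (client_loss L j) w) 0 i =
    2 * \sum_(j < m) self_force (client_loss L j) w 0 i.
  by rewrite mulr_sumr; apply: eq_bigr => j _; rewrite mxE.
have e2 : \sum_(j < m) (1 *: \sum_(k < E) 2 *: self_force (L j k) w) 0 i =
    2 * \sum_(j < m) \sum_(k < E) self_force (L j k) w 0 i.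
  rewrite mulr_sumr; apply: eq_bigr => j _; rewrite mxE summxE mul1r mulr_sumr.
  by apply: eq_bigr => k _; rewrite mxE.
have e3 : \sum_(j < m) (E%:R^-1 *: \sum_(k < E) self_force (L j k) w) 0 i =
    E%:R^-1 * \sum_(j < m) \sum_(k < E) self_force (L j k) w 0 i.
  by rewrite mulr_sumr; apply: eq_bigr => j _; rewrite mxE summxE.
by rewrite e1 e2 e3; field; rewrite mR ER.
Qed.

(** The variance identity. Applied to each coordinate, it rewrites the deviations of the client
    gradients through [gradsq] alone, whose gradient is known. *)
Lemma sum_sqr_deviation n (a : 'I_n -> R) : (0 < n)%N ->
  \sum_(j < n) (n%:R^-1 * \sum_(j < n) a j - a j) ^+ 2 =
  \sum_(j < n) a j ^+ 2 - n%:R * (n%:R^-1 * \sum_(j < n) a j) ^+ 2.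
Proof.
move=> n0; set S := \sum_(j < n) a j; set b := _ * S.
under eq_bigr => j _.
  have -> : (b - a j) ^+ 2 = b ^+ 2 + (- (2 * b) * a j + a j ^+ 2) by ring.
  over.
rewrite !big_split /= sumr_const card_ord -mulr_natl -mulr_sumr -/S.
have -> : S = n%:R * b by rewrite /b mulrA mulfV ?mul1r // pnatr_eq0 -lt0n.
by ring.
Qed.

Lemma fedavg_modified_lossE (eta : R) w :
  fedavg_modified_loss L eta w = global_loss L w + eta * loss_correction w.
Proof.
rewrite /fedavg_modified_loss /loss_correction.
have -> : \sum_(j < m) enorm (grad (global_loss L) w - grad (client_loss L j) w) ^+ 2
    = \sum_(j < m) gradsq (client_loss L j) w - m%:R * gradsq (global_loss L) w.
  under eq_bigr do rewrite enorm_sqr.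
  rewrite exchange_big /= /gradsq [X in _ = X - _]exchange_big /= mulr_sumr -sumrB.
  apply: eq_bigr => i _.
  have gE : partial i (global_loss L) w =
      m%:R^-1 * \sum_(j < m) partial i (client_loss L j) w.
    have := congr1 (fun v : 'rV[R]_d => v 0 i) (grad_global w).
    rewrite /= !mxE summxE => ->; congr (_ * _).
    by apply: eq_bigr => j _; rewrite mxE.
  rewrite gE -sum_sqr_deviation //; apply: eq_bigr => j _.
  by rewrite !mxE gE.
have -> : \sum_(j < m) \sum_(k < E) enorm (grad (L j k) w) ^+ 2 =
    \sum_(j < m) 1 * \sum_(k < E) gradsq (L j k) w.
  apply: eq_bigr => j _; rewrite mul1r; apply: eq_bigr => k _.
  exact: enorm_grad_sqr.
by rewrite big_ord1; field; rewrite mR ER.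
Qed.

Lemma grad_fedavg_modified_loss (eta : R) w :
  grad (fedavg_modified_loss L eta) w =
  grad (global_loss L) w + (E%:R * eta) *: drift w.
Proof.
have -> : fedavg_modified_loss L eta =
    (fun w => global_loss L w + eta * loss_correction w).
  by apply/funext => u; exact: fedavg_modified_lossE.
rewrite grad_addZ; last 2 first.
- by case: Ck_global.
- by case: Ck_loss_correction.
by rewrite grad_loss_correction scalerA [eta * _]mulrC.
Qed.

End FedAvgLoss.

(** With one local step a client loss is its only mini-batch loss, so the client and mini-batch sums
    in [loss_correction] cancel. What remains is a quarter of the squared norm of the global
    gradient, which is the SGD correction for an epoch of one batch. *)
Lemma fedavg_single_step (R : realType) (d m : nat)
    (L : 'I_m -> 'I_1 -> 'rV[R]_d -> R) (l : 'I_1 -> 'rV[R]_d -> R)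
    (eta : R) (w : 'rV[R]_d) : (0 < m)%N -> (forall j k, Ck 3 (L j k)) ->
  sgd_loss l = global_loss L ->
  fedavg_modified_loss L eta w = sgd_modified_loss l eta w.
Proof.
move=> m0 CL lL.
have l0 : l 0 = global_loss L.
  by rewrite -lL; apply/funext => u; rewrite /sgd_loss invr1 mul1r big_ord1.
have Lj j : client_loss L j = L j 0.
  by apply/funext => u; rewrite /client_loss invr1 mul1r big_ord1.
rewrite fedavg_modified_lossE // /sgd_modified_loss lL /loss_correction.
rewrite !big_ord1 l0 enorm_grad_sqr.
under eq_bigr do rewrite Lj.
under [X in _ - (_ - _ * X)]eq_bigr do rewrite big_ord1 mul1r.
by field; rewrite pnatr_eq0 -lt0n.
Qed.

(** * Expansion of shuffled local steps *)

Section OrderedPairs.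
Context {I : eqType} {Z : zmodType}.
Variable a : I -> I -> Z.

(* The sum of [a x y] over the pairs where [y] occurs before [x] in the list. *)
Fixpoint pair_sum (l : seq I) : Z :=
  if l is y :: l' then pair_sum l' + \sum_(x <- l') a x y else 0.

Lemma pair_sum_rcons l x :
  pair_sum (rcons l x) = pair_sum l + \sum_(y <- l) a x y.
Proof.
elim: l => [|z l IH] /=; first by rewrite !big_nil.
rewrite IH -cats1 big_cat big_seq1 big_cons /=.
by rewrite addrACA [_ + a x z]addrC.
Qed.

(** Two distinct positions are met in one order in [l] and in the other in [rev l]; together they
    fill the double sum except for the diagonal. *)
Lemma pair_sum_rev l : pair_sum l + pair_sum (rev l) =
  \sum_(x <- l) \sum_(y <- l) a x y - \sum_(x <- l) a x x.
Proof.
elim: l => [|z l IH]; first by rewrite /rev /= !big_nil subrr addr0.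
rewrite rev_cons pair_sum_rcons /= !big_cons.
under [X in _ + X - _]eq_bigr do rewrite big_cons.
rewrite big_split /= [X in _ + (_ + X)](perm_big l) /=; last by rewrite perm_rev.
rewrite addrACA IH.
set S := \sum_(x <- l) \sum_(y <- l) _; set D := \sum_(x <- l) a x x.
set u := \sum_(x <- l) a x z; set v := \sum_(x <- l) a z x.
rewrite -(addrA (a z z)) opprD [RHS]addrACA subrr add0r.
by rewrite [u + v]addrC addrAC [S + _]addrC addrA.
Qed.

End OrderedPairs.

Lemma pair_sum_map (I I' : eqType) (Z : zmodType) (a : I -> I -> Z) (s : I' -> I) l :
  pair_sum (fun x y => a (s x) (s y)) l = pair_sum a (map s l).
Proof. by elim: l => //= x l ->; rewrite big_map. Qed.

Lemma rev_enum_ord n : rev (enum 'I_n) = map (@rev_ord n) (enum 'I_n).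
Proof.
apply: (inj_map val_inj); rewrite map_rev val_enum_ord -map_comp.
rewrite (eq_map (g := (fun k => n - k.+1)%N \o val)) // map_comp val_enum_ord.
apply: (@eq_from_nth _ 0%N) => [|i]; rewrite size_rev size_iota ?size_map ?size_iota //.
move=> ni; rewrite nth_rev size_iota // (nth_map 0%N) ?size_iota //.
by rewrite !nth_iota //; case: n ni => // n ni; rewrite ltn_subrL.
Qed.

Lemma sum_map_perm_enum (Z : zmodType) n (s : 'S_n) (F : 'I_n -> Z) :
  \sum_(x <- map s (enum 'I_n)) F x = \sum_x F x.
Proof.
rewrite big_map big_enum /= [RHS](reindex_inj (@perm_inj _ s)) /=.
by apply: eq_bigl => x; rewrite inE.
Qed.

(** Reindexing one of two copies of the sum by [phi] makes each term of the doubled sum equal to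
    [2 *: t]. The point [s0] makes the cardinal invertible. *)
Lemma mean_bij_invariant (R : numFieldType) (V : lmodType R) (S : finType) (s0 : S)
    (phi : S -> S) (T : S -> V) (t : V) :
  injective phi -> (forall s, T s + T (phi s) = 2 *: t) ->
  #|S|%:R^-1 *: \sum_s T s = t.
Proof.
move=> phiI TE; have S0 : #|S|%:R != 0 :> R.
  by rewrite pnatr_eq0 -lt0n; apply/card_gt0P; exists s0.
have two : 2 != 0 :> R by rewrite pnatr_eq0.
have sumE : 2 *: \sum_s T s = #|S|%:R *: (2 *: t).
  rewrite [LHS]scaler_nat mulr2n {2}(reindex_inj phiI) -big_split /=.
  by rewrite (eq_bigr (fun=> 2 *: t)) // sumr_const [RHS]scaler_nat.
apply: (scalerI two).
by rewrite scalerA mulrC -scalerA sumE [LHS]scalerA mulVf // scale1r.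
Qed.

Section LocalSteps.
Context {R : realType} {d : nat} {I : eqType}.
Variables (A : set 'rV[R]_d) (K eta h : R) (w0 : 'rV[R]_d).
Variables (F : I -> 'rV[R]_d -> 'rV[R]_d) (J : I -> 'rV[R]_d -> 'M[R]_d).
Hypotheses (K0 : 0 <= K) (eta0 : 0 <= eta) (h0 : 0 <= h).
Hypothesis ballA : forall w, `|w - w0| <= h * K -> A w.
Hypothesis FJ : forall k, field_bounds A K (F k) (J k).

Let u l := foldl (fun w k => w - eta *: F k w) w0 l.
Let P := pair_sum (fun x y => F y w0 *m J x w0).

(** The three bounds are one induction on the last step. The first keeps the iterate in [A]; the
    second replaces the displacement by minus the summed fields, and the third uses it inside the
    linear term of the next field. Each bound is proportional to the elapsed time
    [(size l)%:R * eta], so a step only has to add its share. *)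
Lemma local_steps_expansion l : (size l)%:R * eta <= h ->
  [/\ `|u l - w0| <= (size l)%:R * eta * K,
      `|u l - w0 + eta *: \sum_(k <- l) F k w0| <= (size l)%:R * eta * (K ^+ 2 * h) &
      `|u l - (w0 - eta *: \sum_(k <- l) F k w0 + eta ^+ 2 *: P l)|
         <= (size l)%:R * eta * (2 * K ^+ 3 * h ^+ 2)].
Proof.
have Aw0 : A w0 by apply: ballA; rewrite subrr normr0 mulr_ge0.
elim/last_ind: l => [_|l k IH].
  by rewrite /u /P /= big_nil !scaler0 subrr !addr0 subr0 subrr !normr0 !mul0r.
rewrite size_rcons -natr1 mulrDl mul1r => lh.
have lh' : (size l)%:R * eta <= h by rewrite (le_trans _ lh) // lerDl.
have [I1 I2 I3] := IH lh'.
have uh : `|u l - w0| <= h * K by rewrite (le_trans I1) // ler_wpM2r.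
have Au : A (u l) by exact: ballA.
have [B1 B2 B3 B4] := FJ k.
rewrite /P pair_sum_rcons -/P -cats1 big_cat big_seq1 /= cats1.
rewrite /u foldl_rcons -/(u l) -mulmx_suml.
set S := \sum_(k <- l) F k w0 in I2 I3 *; set U := u l in uh Au I1 I2 I3 *.
split.
- rewrite addrAC mulrDl; apply: le_trans (ler_normB _ _) _.
  by apply: lerD => //; rewrite normrZ ger0_norm // ler_wpM2l // B1.
- have -> : U - eta *: F k U - w0 + eta *: (S + F k w0)
      = (U - w0 + eta *: S) - eta *: (F k U - F k w0).
    by apply/rowP => i; rewrite !mxE; ring.
  rewrite mulrDl; apply: le_trans (ler_normB _ _) _; apply: lerD => //.
  rewrite normrZ ger0_norm // ler_wpM2l // (le_trans (B2 _ _ _ _)) //.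
  by rewrite expr2 -mulrA ler_wpM2l // mulrC.
- have -> : U - eta *: F k U - (w0 - eta *: (S + F k w0)
        + eta ^+ 2 *: (P l + S *m J k w0))
      = (U - (w0 - eta *: S + eta ^+ 2 *: P l))
        - (eta *: (F k U - F k w0 - (U - w0) *m J k w0)
           + eta *: ((U - w0 + eta *: S) *m J k w0)).
    rewrite [(_ - _ + _) *m _]mulmxDl -scalemxAl.
    move: ((U - w0) *m _) (S *m _) (P l) => X Y Z.
    by apply/rowP => i; rewrite !mxE; ring.
  rewrite mulrDl; apply: le_trans (ler_normB _ _) _; apply: lerD => //.
  apply: le_trans (ler_normD _ _) _.
  rewrite !normrZ ger0_norm // -mulrDr ler_wpM2l //.
  (* The Taylor remainder of the field at distance at most [h * K], and the first-order error of the
     iterate carried through the Jacobian. *)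
  have -> : 2 * K ^+ 3 * h ^+ 2 = K * (h * K) ^+ 2 + K * (h * (K ^+ 2 * h)) by ring.
  apply: lerD.
    apply: (le_trans (B4 _ _ _ _)) => //.
    by rewrite ler_wpM2l // lerXn2r ?nnegrE ?mulr_ge0.
  apply: (le_trans (B3 _ _ _)) => //; rewrite ler_wpM2l // (le_trans I2) //.
  by rewrite ler_wpM2r // mulr_ge0 // sqr_ge0.
Qed.

End LocalSteps.

Section ExpectedRound.
Context {R : realType} {d m E : nat}.
Variable L : 'I_m -> 'I_E -> 'rV[R]_d -> R.
Hypotheses (m0 : (0 < m)%N) (E0 : (0 < E)%N) (CL : forall j k, Ck 3 (L j k)).
Variables (A : set 'rV[R]_d) (K eta : R) (w0 : 'rV[R]_d).
Hypotheses (K0 : 0 <= K) (eta0 : 0 <= eta).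
Let h : R := E%:R * eta.
Hypothesis ballA : forall w, `|w - w0| <= h * K -> A w.
Hypothesis FJ : forall j k, field_bounds A K (grad (L j k)) (hess (L j k)).

Let h0 : 0 <= h. Proof. by rewrite mulr_ge0. Qed.
Let mR : m%:R != 0 :> R. Proof. by rewrite pnatr_eq0 -lt0n. Qed.
Let ER : E%:R != 0 :> R. Proof. by rewrite pnatr_eq0 -lt0n. Qed.

Let a j (x y : 'I_E) := grad (L j y) w0 *m hess (L j x) w0.

Definition local_approx j (s : 'S_E) : 'rV[R]_d :=
  w0 - h *: grad (client_loss L j) w0
  + eta ^+ 2 *: pair_sum (a j) (map s (enum 'I_E)).

Lemma grad_client j w :
  E%:R *: grad (client_loss L j) w = \sum_(k < E) grad (L j k) w.
Proof.
rewrite grad_lincomb; last by move=> k u; case: (CL j k).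
by rewrite scalerA mulfV // scale1r.
Qed.

Lemma hess_client j w :
  E%:R *: hess (client_loss L j) w = \sum_(k < E) hess (L j k) w.
Proof.
rewrite hess_lincomb; last by move=> k; exact/CkW/CL.
by rewrite scalerA mulfV // scale1r.
Qed.

Lemma local_update_approx j (s : 'S_E) :
  `|local_update (L j) s eta w0 - local_approx j s| <= 2 * K ^+ 3 * h ^+ 3.
Proof.
have size_h : (size (enum 'I_E))%:R * eta <= h by rewrite size_enum_ord.
have [_ _] := local_steps_expansion K0 eta0 h0 ballA (fun k => FJ j (s k)) size_h.
rewrite (pair_sum_map (a j)) size_enum_ord -/h -(big_map s xpredT (fun k => grad (L j k) w0)).
rewrite sum_map_perm_enum -grad_client scalerA [eta * _]mulrC => H.
by apply: (le_trans H); rewrite le_eqVlt; apply/orP; left; apply/eqP; ring.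
Qed.

(** The full double sum no longer sees the order [s], and it factors into the summed gradients times
    the summed Hessians, that is, into client quantities. *)
Lemma pair_sum_perm j (s : 'S_E) :
  pair_sum (a j) (map s (enum 'I_E)) + pair_sum (a j) (rev (map s (enum 'I_E)))
  = E%:R ^+ 2 *: self_force (client_loss L j) w0
    - \sum_(k < E) self_force (L j k) w0.
Proof.
rewrite pair_sum_rev; congr (_ - _); last exact: sum_map_perm_enum.
rewrite (sum_map_perm_enum s (fun x => \sum_(y <- map s (enum 'I_E)) a j x y)).
under eq_bigr => x _ do rewrite (sum_map_perm_enum s (a j x)) -mulmx_suml.
rewrite -mulmx_sumr -grad_client -hess_client.
by rewrite -scalemxAl -scalemxAr scalerA -expr2.
Qed.

(** Written in the shape that the flow expansion produces for the field [grad (global_loss L)]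
    perturbed by [h *: drift L], so that the two can be subtracted term by term. *)
Definition round_approx : 'rV[R]_d :=
  w0 - h *: (grad (global_loss L) w0 + h *: drift L w0)
  + (h ^+ 2 / 2) *: self_force (global_loss L) w0.

Let rev_perm : 'S_E := perm (@rev_ord_inj E).

(* Reversing every client's order exchanges the ordered pairs of steps with
   their transposes, so a shuffle and its reverse have a constant sum. *)
Let reverse (s : {ffun 'I_m -> 'S_E}) := [ffun j => (rev_perm * s j)%g].

Let reverse_inj : injective reverse.
Proof.
have rr : (rev_perm * rev_perm = 1)%g.
  by apply/permP => i; rewrite permM perm1 !permE rev_ordK.
apply: can_inj (reverse) _ => s; apply/ffunP => j.
by rewrite !ffunE mulgA rr mul1g.
Qed.

Let map_reverse s j : map (reverse s j) (enum 'I_E) = rev (map (s j) (enum 'I_E)).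
Proof.
rewrite -map_rev rev_enum_ord -[RHS]map_comp; apply: eq_map => k.
by rewrite ffunE permM permE.
Qed.

(** The origin of [drift]: the mean over orders gives [h^2/2] times the mean client self-force minus
    [E^-1] times the mean mini-batch self-force. In [round_approx] the global self-force inside
    [drift] cancels the one of the quadratic term, which leaves the same expression. *)
Lemma mean_local_approx :
  #|{ffun 'I_m -> 'S_E}|%:R^-1 *:
    (\sum_(s : {ffun 'I_m -> 'S_E}) m%:R^-1 *: \sum_(j < m) local_approx j (s j))
  = round_approx.
Proof.
apply: (mean_bij_invariant [ffun=> 1%g] reverse_inj) => s.
rewrite -scalerDr -big_split /=.
have pairE j : local_approx j (s j) + local_approx j (reverse s j) =
    2 *: w0 - (2 * h) *: grad (client_loss L j) w0 + eta ^+ 2 *: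
     (E%:R ^+ 2 *: self_force (client_loss L j) w0
      - \sum_(k < E) self_force (L j k) w0).
  rewrite -(pair_sum_perm j (s j)) -map_reverse /local_approx.
  move: (pair_sum _ _) (pair_sum _ _) => X Y.
  by apply/rowP => i; rewrite !mxE; ring.
under eq_bigr do rewrite pairE.
rewrite !big_split /= sumr_const card_ord sumrN -!scaler_sumr big_split /=.
rewrite sumrN -!scaler_sumr /round_approx /drift grad_global //.
rewrite -[\sum_(j < m) E%:R^-1 *: _]scaler_sumr.
rewrite -(scaler_nat m (2 *: w0)).
move: (\sum_(j < m) grad _ _) => X; move: (\sum_(j < m) self_force _ _) => Y.
move: (\sum_(j < m) \sum_(k < E) _) (self_force _ _) => Z T.
apply/rowP => i; rewrite !mxE /h; field.
by rewrite mR ER.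
Qed.

Lemma expected_round_expansion :
  `|expected_round L eta w0 - round_approx| <= 2 * K ^+ 3 * h ^+ 3.
Proof.
rewrite -mean_local_approx /expected_round -scalerBr -sumrB.
apply: normr_mean_fin => [|s]; first by apply/card_gt0P; exists [ffun=> 1%g].
rewrite /fedavg_round -scalerBr -sumrB; apply: normr_mean => // j.
exact: local_update_approx.
Qed.

End ExpectedRound.

(** * Expansion of a flow *)

Section FlowExpansion.
Context {R : realType} {d : nat}.
Implicit Types (w v a b : 'rV[R]_d) (g : R -> 'rV[R]_d).

Lemma is_derive_quadratic a b (t : R) :
  is_derive t (1 : R) (fun s : R => s *: a + (s ^+ 2 / 2) *: b) (a + t *: b).
Proof.
apply: is_derive_row => i.
have -> : (fun s : R => (s *: a + (s ^+ 2 / 2) *: b) 0 i) =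
    a 0 i *: id + (b 0 i / 2) *: (id ^+ 2).
  apply/funext => s; rewrite !mxE.
  by transitivity (a 0 i * s + b 0 i / 2 * s ^+ 2); first by ring.
have D := is_deriveD (is_deriveZ (a 0 i) (is_derive_id t 1))
  (is_deriveZ (b 0 i / 2) (is_deriveX 2 (is_derive_id t 1))).
by apply: (is_derive_eq D); rewrite !mxE /GRing.scale /=; field.
Qed.

(** Comparison with a quadratic path of velocity [- (a + s *: b)]. With [b = 0] it gives the
    first-order estimate that the second-order one relies on. *)
Lemma flow_deviation g (dg : R -> 'rV[R]_d) a b (T c t : R) :
  {within `[0, T], continuous g} ->
  (forall s, 0 < s < T -> is_derive s 1 g (dg s)) ->
  (forall s, 0 < s < T -> `|dg s + (a + s *: b)| <= c) ->
  0 <= t <= T ->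
  `|g t - g 0 + (t *: a + (t ^+ 2 / 2) *: b)| <= c * t.
Proof.
move=> cg Dg dgc /andP[t0 tT]; pose q (s : R) := s *: a + (s ^+ 2 / 2) *: b.
have [p pE] : exists p : R -> 'rV[R]_d, p = g + q by exists (g + q).
have -> : g t - g 0 + (t *: a + (t ^+ 2 / 2) *: b) = p t - p 0.
  by apply/rowP => i; rewrite pE !fctE /q !mxE; ring.
rewrite -[X in c * X]subr0.
apply: (@mean_value_rV R d p (fun s => dg s + (a + s *: b)) 0 t c t0).
- have cg' : {within `[0, t], continuous g}.
    apply: continuous_subspaceW cg => u /=; rewrite !in_itv /=.
    by move=> /andP[-> ut]; exact: le_trans ut tT.
  have cq : {within `[0, t], continuous q}.
    by apply: derivable_within_continuous => s _; case: (is_derive_quadratic a b s).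
  by rewrite pE => s; apply: continuousD; [exact: cg'|exact: cq].
- move=> s /andP[s0 st]; rewrite pE; apply: is_deriveD; last exact: is_derive_quadratic.
  by apply: Dg; rewrite s0 (lt_le_trans st).
- by move=> s /andP[s0 st]; apply: dgc; rewrite s0 (lt_le_trans st).
Qed.

Variables (A : set 'rV[R]_d) (K B T rho eps sigma : R) (w0 : 'rV[R]_d).
Variables (F s : 'rV[R]_d -> 'rV[R]_d) (J : 'rV[R]_d -> 'M[R]_d).
Hypotheses (K0 : 0 <= K) (B0 : 0 <= B) (T0 : 0 <= T) (rho0 : 0 < rho).
Hypothesis FJ : field_bounds A K F J.
Hypothesis ballA : forall w, `|w - w0| < rho -> A w.
Hypothesis BT : B * T < rho.
Hypothesis FsB : forall w, `|w - w0| < rho -> `|F w + s w| <= B.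
Hypothesis s_eps : forall w, `|w - w0| <= B * T -> `|s w - s w0| <= eps.
Hypothesis s_sigma : `|s w0| <= sigma.

(** Of the perturbation [s] only its oscillation [eps] and its size [sigma] at [w0] enter. The
    statement thus serves both the FedAvg loss, whose drift is Lipschitz, and an arbitrary
    candidate, whose correction has a merely continuous gradient. The proof traps the path,
    estimates it to first order ([dev1]), and inserts this into the expansion of the velocity. *)
Lemma flow_expansion g : g 0 = w0 -> {within `[0, T], continuous g} ->
  (forall t, 0 < t < T -> is_derive t 1 g (- (F (g t) + s (g t)))) ->
  `|g T - (w0 - T *: (F w0 + s w0) + (T ^+ 2 / 2) *: (F w0 *m J w0))|
    <= T * (K * (B * T) ^+ 2 + K * (T * (K * (B * T) + eps + sigma)) + eps).
Proof.
move=> g0 cg Dg; have [B1 B2 B3 B4] := FJ.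
have gB t : 0 <= t <= T -> `|g t - w0| <= B * T.
  move=> /andP[t0 tT]; apply: (@le_trans _ _ (B * t)); last by rewrite ler_wpM2l.
  apply: (speed_bound cg g0 Dg _ B0 BT rho0); last by rewrite t0.
  by move=> u _ /FsB; rewrite normrN.
have gA t : 0 <= t <= T -> A (g t).
  by move=> /gB gt; apply: ballA; exact: le_lt_trans gt BT.
have Aw0 : A w0 by apply: ballA; rewrite subrr normr0.
have ltW2 t : 0 < t < T -> 0 <= t <= T by move=> /andP[/ltW -> /ltW ->].
have eps0 : 0 <= eps.
  by apply: le_trans (normr_ge0 _) (s_eps (w := w0) _); rewrite subrr normr0 mulr_ge0.
have sigma0 : 0 <= sigma by exact: le_trans s_sigma.
set c := K * (B * T) + eps + sigma.
have c0 : 0 <= c by rewrite !addr_ge0 // !mulr_ge0.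
have dev1 t : 0 <= t <= T -> `|g t - w0 + t *: F w0| <= c * t.
  move=> tT; have -> : g t - w0 + t *: F w0
      = g t - g 0 + (t *: F w0 + (t ^+ 2 / 2) *: 0) by rewrite scaler0 addr0 g0.
  apply: (flow_deviation cg Dg _ tT) => u uT.
  rewrite scaler0 addr0.
  have -> : - (F (g u) + s (g u)) + F w0
      = - (F (g u) - F w0) - (s (g u) - s w0) - s w0.
    by apply/rowP => i; rewrite !mxE; ring.
  rewrite (le_trans (ler_normB _ _)) // lerD //.
  rewrite (le_trans (ler_normB _ _)) // normrN lerD //; last by apply/s_eps/gB/ltW2.
  rewrite (le_trans (B2 _ _ _ _)) //; first by apply/gA/ltW2.
  by rewrite ler_wpM2l //; apply/gB/ltW2.
have TT : 0 <= T <= T by rewrite T0 lexx.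
have := @flow_deviation g _ (F w0 + s w0) (- (F w0 *m J w0)) T
  (K * (B * T) ^+ 2 + K * (T * c) + eps) T cg Dg.
have -> : g T - g 0 + (T *: (F w0 + s w0) + T ^+ 2 / 2 *: - (F w0 *m J w0)) =
    g T - (w0 - T *: (F w0 + s w0) + (T ^+ 2 / 2) *: (F w0 *m J w0)).
  by rewrite g0; move: (F w0 *m _) => Y; apply/rowP => i; rewrite !mxE; ring.
move=> H; rewrite [leRHS]mulrC; apply: H => // t tT.
have -> : - (F (g t) + s (g t)) + (F w0 + s w0 + t *: - (F w0 *m J w0)) =
  - (F (g t) - F w0 - (g t - w0) *m J w0)
  - (g t - w0 + t *: F w0) *m J w0 - (s (g t) - s w0).
  rewrite [(_ - _ + _) *m _]mulmxDl -scalemxAl.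
  move: ((g t - w0) *m _) (F w0 *m _) => X Y.
  by apply/rowP => i; rewrite !mxE; ring.
rewrite (le_trans (ler_normB _ _)) // lerD //; last by apply/s_eps/gB/ltW2.
rewrite (le_trans (ler_normB _ _)) // normrN lerD //.
  rewrite (le_trans (B4 _ _ _ _)) //; first by apply/gA/ltW2.
  rewrite ler_wpM2l // lerXn2r ?nnegrE ?mulr_ge0 //; exact/gB/ltW2.
rewrite (le_trans (B3 _ _ _)) // ler_wpM2l // (le_trans (dev1 _ (ltW2 _ tT))) //.
by rewrite mulrC ler_wpM2r //; case/andP: tT => _ /ltW.
Qed.

End FlowExpansion.

(** * Existence of flows *)

Section Existence.
Context {R : realType} {d : nat}.
Implicit Types (w v x y : 'rV[R]_d) (g : R -> 'rV[R]_d).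

Lemma ler_of_geometric (a b c : R) :
  (forall n, a <= b + c / 2 ^+ n) -> a <= b.
Proof.
move=> H; apply/ler_addgt0Pr => e e0.
have [c0|c0] := leP c 0.
  apply: (le_trans (H 0%N)); rewrite expr0 divr1 lerD2l.
  by rewrite (le_trans c0) // ltW.
pose n := Num.bound (c / e).
apply: (le_trans (H n)); rewrite lerD2l ler_pdivrMr ?exprn_gt0 //.
rewrite mulrC -ler_pdivrMr //.
have : c / e < n%:R by apply: archi_boundP; rewrite divr_ge0 // ltW.
by move/ltW/le_trans; apply; rewrite -natrX ler_nat ltnW // ltn_expl.
Qed.

(** The intervals of radius [2 * D / 2 ^+ n] around [x n] are nested; the supremum of their lower
    ends lies in all of them. *)
Lemma geometric_limit (x : nat -> R) (D : R) :
  (forall n, `|x n.+1 - x n| <= D / 2 ^+ n) ->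
  exists l, forall n, `|l - x n| <= 2 * D / 2 ^+ n.
Proof.
move=> xD; have p2 n : 0 < 2 ^+ n :> R by rewrite exprn_gt0.
have D0 : 0 <= D.
  by have := le_trans (normr_ge0 _) (xD 0%N); rewrite expr0 divr1.
have step n : 2 * D / 2 ^+ n = 2 * D / 2 ^+ n.+1 + D / 2 ^+ n.
  by rewrite exprS; field; rewrite gt_eqF.
have lo n k : x n - 2 * D / 2 ^+ n <= x (n + k)%N - 2 * D / 2 ^+ (n + k).
  elim: k => [|k IH]; first by rewrite addn0.
  rewrite addnS (le_trans IH) // (step (n + k)%N).
  by have := xD (n + k)%N; rewrite ler_norml => /andP[+ _]; lra.
have hi n k : x (n + k)%N + 2 * D / 2 ^+ (n + k) <= x n + 2 * D / 2 ^+ n.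
  elim: k => [|k IH]; first by rewrite addn0.
  rewrite addnS (le_trans _ IH) // (step (n + k)%N).
  by have := xD (n + k)%N; rewrite ler_norml => /andP[_]; lra.
have pos n : 0 <= 2 * D / 2 ^+ n by rewrite divr_ge0 ?mulr_ge0 // ltW.
have cross n k : x n - 2 * D / 2 ^+ n <= x k + 2 * D / 2 ^+ k.
  have := lo n k; have := hi k n; rewrite [(k + n)%N]addnC.
  by have := pos (n + k)%N; lra.
pose S := range (fun n => x n - 2 * D / 2 ^+ n).
have supS : has_sup S.
  split; first by exists (x 0%N - 2 * D / 2 ^+ 0), 0%N.
  by exists (x 0%N + 2 * D / 2 ^+ 0) => _ [n _ <-].
exists (sup S) => n; rewrite ler_norml; apply/andP; split.
  rewrite lerBrDr addrC; apply: (ub_le_sup supS.2); by exists n.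
rewrite lerBlDr addrC; apply: ge_sup; first exact: supS.1.
by move=> _ [k _ <-].
Qed.

Lemma lipschitz_continuous g (B : R) :
  (forall s t, `|g t - g s| <= B * `|t - s|) -> continuous g.
Proof.
move=> gB t; apply/cvgrPdist_lt => e e0.
have B1 : 0 < `|B| + 1 by rewrite ltr_wpDl.
apply/nbhs_ballP; exists (e / (`|B| + 1)) => [|s]; first exact: divr_gt0.
rewrite /ball /= ltr_pdivlMr // => H; apply: le_lt_trans (gB _ _) _.
apply: le_lt_trans H; rewrite mulrC ler_wpM2l //.
by rewrite (le_trans (ler_norm _)) // lerDl.
Qed.

Lemma antiderivative (h : R -> R) (T : R) : 0 < T -> continuous h ->
  exists H : R -> R, forall t, -1 < t < T + 1 -> is_derive t 1 H (h t).
Proof.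
move=> T0 ch.
(* Starting at -1 puts [[0, T]] in the interior, where the derivative is two-sided. *)
exists (fun r : R => \int[lebesgue_measure]_(t in [set` `[-1, r]]) h t)%R.
move=> t /andP[t1 tT].
have hint : (@lebesgue_measure R).-integrable `[-1, T + 1] (EFin \o h).
  apply: continuous_compact_integrable; first exact: segment_compact.
  exact: continuous_subspaceT.
have [D DE] := continuous_FTC1_closed tT hint t1 (ch t).
by apply: DeriveDef; [exact: D|rewrite -derive1E DE].
Qed.

Lemma antiderivative_rV g (T : R) : 0 < T -> continuous g ->
  exists H : R -> 'rV[R]_d, forall t, -1 < t < T + 1 -> is_derive t 1 H (g t).
Proof.
move=> T0 cg.
have /choice[H HE] : forall i, exists h : R -> R,
    forall t, -1 < t < T + 1 -> is_derive t 1 h (g t 0 i).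
  move=> i; apply: antiderivative => // t.
  exact: (continuous_comp (cg t) (@coord_continuous _ _ _ 0 i (g t))).
exists (fun t => \row_i H i t) => t tT; apply: is_derive_row => i.
have -> : (fun s => (\row_i0 H i0 s : 'rV[R]_d) 0 i) = H i.
  by apply/funext => s; rewrite mxE.
exact: HE.
Qed.

Definition clamp (T t : R) : R := Num.max 0 (Num.min t T).

Lemma clamp_itv (T t : R) : 0 <= T -> 0 <= clamp T t <= T.
Proof. by move=> T0; rewrite /clamp le_max lexx ge_max T0 ge_min lexx orbT. Qed.

Lemma clamp_id (T t : R) : 0 <= t <= T -> clamp T t = t.
Proof. by move=> /andP[t0 tT]; rewrite /clamp min_l // max_r. Qed.

Lemma clamp_lipschitz (T s t : R) : 0 <= T -> `|clamp T t - clamp T s| <= `|t - s|.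
Proof.
move=> T0; rewrite /clamp.
case: (leP t T) => ?; case: (leP s T) => ?; rewrite ?maxEle;
  repeat case: ifP => [?|/negbT]; rewrite -?ltNge; move=> *;
  rewrite ler_norml; apply/andP; split; rewrite ?lerBrDr ?lerBlDr;
  have := ler_norm (t - s); have := ler_norm (- (t - s)); rewrite normrN; lra.
Qed.

Variables (Y : 'rV[R]_d -> 'rV[R]_d) (B K T : R) (w0 : 'rV[R]_d).
Hypotheses (B0 : 0 <= B) (K0 : 0 <= K) (T0 : 0 < T) (TK : T * K <= 2^-1).
Hypothesis YB : forall x, `|Y x| <= B.
Hypothesis YK : forall x y, `|Y x - Y y| <= K * `|x - y|.

(* The clause [v t = v (clamp T t)] keeps the iterates defined and continuous on
   the whole line, where limits are taken. *)
Definition picard_image (u v : R -> 'rV[R]_d) : Prop :=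
  [/\ v 0 = w0, forall s t, `|v t - v s| <= B * `|t - s|,
      forall t, v t = v (clamp T t) &
      forall t, 0 < t < T -> is_derive t 1 v (Y (u t))].

Lemma picard_image_exists (u : R -> 'rV[R]_d) :
  continuous u -> exists g, picard_image u g.
Proof.
move=> cu.
have cY : continuous (fun t => Y (u t)).
  move=> t; apply/cvgrPdist_lt => e e0.
  have K1 : 0 < K + 1 by rewrite ltr_wpDl.
  have eK : 0 < e / (K + 1) by exact: divr_gt0.
  have /cvgrPdist_lt/(_ _ eK) := cu t.
  apply: filterS => s /=; rewrite ltr_pdivlMr // mulrC => H.
  apply: le_lt_trans (YK _ _) _; apply: le_lt_trans H.
  by rewrite ler_wpM2r // lerDl.
have [H HE] := antiderivative_rV T0 cY.
have inI t : 0 <= t <= T -> -1 < t < T + 1 by move=> /andP[? ?]; apply/andP; lra.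
have Tge : 0 <= T by exact: ltW.
exists (fun t => w0 + (H (clamp T t) - H 0)); split.
- by rewrite clamp_id ?lexx // subrr addr0.
- have le_case s t : s <= t ->
      `|H (clamp T t) - H (clamp T s)| <= B * `|t - s|.
    move=> st; have /andP[cs0 csT] := clamp_itv s Tge.
    have /andP[ct0 ctT] := clamp_itv t Tge.
    have cst : clamp T s <= clamp T t.
      by rewrite /clamp ge_max !le_max lexx /= le_min !ge_min st lexx !orbT.
    apply: (@le_trans _ _ (B * (clamp T t - clamp T s))).
      apply: (@mean_value_rV R d H (fun t => Y (u t))) => //.
      + apply: derivable_within_continuous => r; rewrite in_itv /= => /andP[r1 r2].
        have rI : -1 < r < T + 1.
          by apply: inI; rewrite (le_trans cs0) // (le_trans r2).
        by case: (HE r rI).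
      + move=> r /andP[r1 r2]; apply/HE/inI.
        by rewrite (le_trans cs0 (ltW r1)) (le_trans (ltW r2) ctT).
    rewrite ler_wpM2l //; apply: le_trans (clamp_lipschitz s t Tge).
    exact: ler_norm.
  move=> s t; have -> : w0 + (H (clamp T t) - H 0) - (w0 + (H (clamp T s) - H 0))
      = H (clamp T t) - H (clamp T s) by apply/rowP => i; rewrite !mxE; ring.
  have [st|/ltW ts] := leP s t; first exact: le_case.
  by rewrite distrC [X in B * X]distrC; exact: le_case.
- by move=> t; rewrite (@clamp_id T (clamp T t)) // clamp_itv.
- move=> t tT; have tI : -1 < t < T + 1.
    by apply: inI; case/andP: tT => /ltW -> /ltW ->.
  have Ht := HE t tI.
  have Dt : is_derive t 1 (fun t => w0 + (H t - H 0)) (Y (u t)).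
    have -> : (fun t => w0 + (H t - H 0)) = cst (w0 - H 0) + H.
      by apply/funext => s; rewrite fctE /= addrAC addrA.
    rewrite -[Y (u t)]add0r; exact: is_deriveD.
  apply: (near_eq_is_derive _ Dt).
  have /near_in_itvoo : t \in `]0, T[ by rewrite in_itv.
  apply: filterS => s; rewrite in_itv /= => /andP[/ltW s0 /ltW sT].
  by rewrite clamp_id // s0.
Qed.

(** Both images start at [w0] and drift apart at speed at most [K * c] for a time at most [T]; the
    factor 1/2 is [TK]. Clamping extends the bound to all times. *)
Lemma picard_image_contracts (u u' v v' : R -> 'rV[R]_d) (c : R) :
  picard_image u v -> picard_image u' v' ->
  (forall t, `|u t - u' t| <= c) -> forall t, `|v t - v' t| <= c / 2.
Proof.
move=> [v0 vB vc Dv] [v0' vB' vc' Dv'] uu' t.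
have Tge : 0 <= T by exact: ltW.
have c0 : 0 <= c by exact: le_trans (normr_ge0 _) (uu' 0).
rewrite vc vc'; have /andP[ct0 ctT] := clamp_itv t Tge.
have [p pE] : exists p : R -> 'rV[R]_d, p = v - v' by exists (v - v').
have -> : v (clamp T t) - v' (clamp T t) = p (clamp T t) - p 0.
  by rewrite pE !fctE v0 v0' subrr subr0.
apply: (@le_trans _ _ (K * c * (clamp T t - 0))); last first.
  rewrite subr0 mulrC mulrA [c / 2]mulrC ler_wpM2r // (le_trans _ TK) //.
  by rewrite ler_wpM2r.
apply: (@mean_value_rV R d p (fun s => Y (u s) - Y (u' s))) => //.
- apply: continuous_subspaceT; rewrite pE => s.
  by apply: continuousB; apply: lipschitz_continuous.
- move=> s /andP[s0 st]; have sT : 0 < s < T by rewrite s0 (lt_le_trans st).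
  by rewrite pE; apply: is_deriveB; [exact: Dv|exact: Dv'].
- by move=> s _; apply: (le_trans (YK _ _)); rewrite ler_wpM2l.
Qed.

Lemma flow_exists_lipschitz : exists u, [/\ u 0 = w0,
  forall s t, `|u t - u s| <= B * `|t - s| &
  forall t, 0 < t < T -> is_derive t 1 u (Y (u t))].
Proof.
have Tge : 0 <= T by exact: ltW.
(* [Phi] is the Picard map on continuous paths; on other paths it returns the path itself as a
   default. *)
have /choice[Phi PhiE] : forall u : R -> 'rV[R]_d, exists g,
    continuous u -> picard_image u g.
  move=> u; have [cu|ncu] := pselect (continuous u); last by exists u => /ncu.
  by have [g ug] := picard_image_exists cu; exists g.
pose u n := iter n Phi (cst w0).
have cP u1 g : picard_image u1 g -> continuous g.
  by case=> _ vB _ _; exact: lipschitz_continuous vB.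
have cu n : continuous (u n).
  by elim: n => [|n IH] /=; [exact: cst_continuous|exact: cP (PhiE _ IH)].
have uS n : picard_image (u n) (u n.+1) by exact: PhiE.
have step n t : `|u n.+1 t - u n t| <= B * T / 2 ^+ n.
  elim: n t => [|n IH] t.
    have [v0 vB vc _] := uS 0%N; rewrite expr0 divr1 vc.
    have /andP[ct0 ctT] := clamp_itv t Tge.
    rewrite [u 0%N _]/= -v0 (le_trans (vB _ _)) // ler_wpM2l //.
    by rewrite subr0 ger0_norm.
  rewrite exprS invfM mulrCA mulrC.
  exact: (picard_image_contracts (uS n.+1) (uS n) IH).
have /choice[l lE] : forall t, exists l : 'rV[R]_d,
    forall n, `|l - u n t| <= 2 * (B * T) / 2 ^+ n.
  move=> t; have /choice[l lE] : forall i, exists l : R,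
      forall n, `|l - u n t 0 i| <= 2 * (B * T) / 2 ^+ n.
    move=> i; apply: geometric_limit => n; apply: le_trans (step n t).
    by rewrite -[leLHS](_ : `|(u n.+1 t - u n t) 0 i| = _) ?ler_coord // !mxE.
  exists (\row_i l i) => n; apply: norm_rV_le => [|i]; last by rewrite !mxE.
  by rewrite divr_ge0 ?mulr_ge0 // exprn_ge0.
(* The common Lipschitz constant survives the limit, so [l] is continuous and [Phi l] is a genuine
   Picard image. *)
have lB s t : `|l t - l s| <= B * `|t - s|.
  apply: (@ler_of_geometric _ _ (2 * (B * T))) => n.
  apply: (@le_trans _ _ (2 * (B * T) / 2 ^+ n.+1 + B * `|t - s|
                         + 2 * (B * T) / 2 ^+ n.+1)); last first.
    by rewrite exprS le_eqVlt; apply/orP; left; apply/eqP; field; rewrite expf_neq0.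
  have -> : l t - l s = (l t - u n.+1 t) + (u n.+1 t - u n.+1 s) - (l s - u n.+1 s).
    by apply/rowP => i; rewrite !mxE; ring.
  apply: le_trans (ler_normB _ _) _; apply: lerD; last exact: lE.
  apply: le_trans (ler_normD _ _) _; apply: lerD; first exact: lE.
  by case: (uS n) => _ + _ _; exact.
have Pl := PhiE l (lipschitz_continuous lB).
have fix_l : Phi l = l.
  apply/funext => t; apply/eqP; rewrite -subr_eq0 -normr_le0.
  apply: (@ler_of_geometric _ _ (2 * (B * T))) => n; rewrite add0r.
  rewrite -(subrKA (u n.+1 t)).
  apply: le_trans (ler_normD _ _) _.
  have -> : 2 * (B * T) / 2 ^+ n
      = 2 * (B * T) / 2 ^+ n / 2 + 2 * (B * T) / 2 ^+ n.+1.
    by rewrite exprS; field; rewrite expf_neq0.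
  apply: lerD; last by rewrite distrC.
  apply: (picard_image_contracts Pl (uS n)) => s; exact: lE.
by exists l; case: Pl; rewrite fix_l => l0 _ _ Dl; split.
Qed.

End Existence.

(** * Localization: flows and derivative bounds on a ball *)

Section LocalFlow.
Context {R : realType} {d : nat}.
Implicit Types (w v x y : 'rV[R]_d).

(** A sup-norm ball is a cube, so clamping each coordinate retracts onto it without increasing
    sup-norm distances. The shift by [r] is needed because [clamp] works on an interval starting at
    0. *)
Definition project (w0 : 'rV[R]_d) (r : R) w : 'rV[R]_d :=
  w0 + \row_i (clamp (2 * r) ((w - w0) 0 i + r) - r).

Lemma project_ball w0 r w : 0 <= r -> `|project w0 r w - w0| <= r.
Proof.
move=> r0; rewrite addrC addKr; apply: norm_rV_le => // i; rewrite mxE.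
have /andP[] := @clamp_itv R (2 * r) ((w - w0) 0 i + r) (mulr_ge0 (ler0n _ 2) r0).
by rewrite ler_norml; move: (clamp _ _) => c c0 cr; apply/andP; split; lra.
Qed.

Lemma project_id w0 r w : `|w - w0| <= r -> project w0 r w = w.
Proof.
move=> wr; rewrite -[RHS](subrKC w0); congr (_ + _); apply/rowP => i; rewrite mxE.
have := le_trans (ler_coord (w - w0) i) wr; rewrite ler_norml => /andP[h1 h2].
by rewrite clamp_id ?addrK //; apply/andP; split; lra.
Qed.

Lemma project_lipschitz w0 r x y : 0 <= r ->
  `|project w0 r x - project w0 r y| <= `|x - y|.
Proof.
move=> r0; apply: norm_rV_le => // i; rewrite !mxE.
set a := x 0 i - _ + r; set b := y 0 i - _ + r.
have -> : w0 0 i + (clamp (2 * r) a - r) - (w0 0 i + (clamp (2 * r) b - r))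
    = clamp (2 * r) a - clamp (2 * r) b by ring.
apply: le_trans (clamp_lipschitz _ _ (mulr_ge0 (ler0n _ 2) r0)) _.
have -> : a - b = (x - y) 0 i by rewrite /a /b !mxE; ring.
exact: ler_coord.
Qed.

(** Precomposition with [project] makes the local bounds global. The resulting path moves at speed
    at most [B], hence stays where the projection is the identity and solves the original
    equation. *)
Lemma local_flow_exists (X : 'rV[R]_d -> 'rV[R]_d) (B K T rho : R) w0 :
  0 <= B -> 0 <= K -> 0 < T -> T * K <= 2^-1 -> B * T < rho ->
  (forall w, `|w - w0| < rho -> `|X w| <= B) ->
  (forall x y, `|x - w0| < rho -> `|y - w0| < rho ->
     `|X x - X y| <= K * `|x - y|) ->
  exists g : R -> 'rV[R]_d, [/\ g 0 = w0, {within `[0, T], continuous g} &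
    forall t, 0 < t < T -> is_derive t 1 g (X (g t))].
Proof.
move=> B0 K0 T0 TK BT XB XK; have BT0 : 0 <= B * T by rewrite mulr_ge0 // ltW.
have proj_in w : `|project w0 (B * T) w - w0| < rho.
  exact: le_lt_trans (project_ball _ _ BT0) BT.
have [||g [g0 gB Dg]] := @flow_exists_lipschitz R d (X \o project w0 (B * T))
    B K T w0 B0 K0 T0 TK.
- by move=> x; exact: XB.
- move=> x y; apply: (le_trans (XK _ _ _ _)) => //.
  by rewrite ler_wpM2l // project_lipschitz.
exists g; split=> //.
  exact/continuous_subspaceT/(lipschitz_continuous gB).
move=> t /andP[t0 tT]; have := Dg t; rewrite t0 tT => /(_ isT) /=.
rewrite project_id // -g0 (le_trans (gB _ _)) // ler_wpM2l //.
by rewrite subr0 gtr0_norm // ltW.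
Qed.

Lemma enorm_le v : enorm v <= d.+1%:R * `|v|.
Proof.
rewrite -(ler_pXn2r (n := 2)) ?nnegrE ?sqrtr_ge0 ?mulr_ge0 // enorm_sqr exprMn.
apply: (@le_trans _ _ (\sum_(i < d) `|v| ^+ 2)).
  apply: ler_sum => i _; rewrite -real_normK ?num_real //.
  by rewrite lerXn2r ?nnegrE ?ler_coord.
rewrite sumr_const card_ord -[leLHS]mulr_natl ler_wpM2r ?sqr_ge0 //.
by rewrite -natrX ler_nat (leq_trans (leqnSn d)) // leq_pmulr.
Qed.

Lemma norm_le_enorm v : `|v| <= enorm v.
Proof.
apply: norm_rV_le => [|i]; first exact: sqrtr_ge0.
rewrite -(ler_pXn2r (n := 2)) ?nnegrE ?sqrtr_ge0 // enorm_sqr real_normK ?num_real //.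
by rewrite (bigD1 i) //= lerDl sumr_ge0 // => j _; exact: sqr_ge0.
Qed.

Lemma ball_segment_closed w0 (rho : R) : segment_closed [set w | `|w - w0| < rho].
Proof.
move=> x y t /= xr yr /andP[t0 t1].
have -> : x + t *: (y - x) - w0 = (1 - t) *: (x - w0) + t *: (y - w0).
  by apply/rowP => i; rewrite !mxE; ring.
apply: le_lt_trans (ler_normD _ _) _; rewrite !normrZ.
rewrite (ger0_norm t0) ger0_norm ?subr_ge0 //.
have -> : rho = (1 - t) * rho + t * rho by ring.
have [t_lt1|] := ltP t 1; last first.
  by move=> t_ge1; rewrite (@le_anti _ _ t 1) ?t1 // subrr !mul0r !add0r !mul1r.
by rewrite ltr_leD // ?ltr_pM2l ?subr_gt0 // ler_wpM2l // ltW.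
Qed.

Lemma partials_boundedW p (A A' : set 'rV[R]_d) (M M' : R) f :
  A `<=` A' -> M <= M' -> partials_bounded p A' M f -> partials_bounded p A M' f.
Proof.
move=> AA' MM'; elim: p f => [//|p IH] f bf i; case: (bf i) => b1 b2.
by split=> [w Aw|]; [exact: le_trans (b1 w (AA' w Aw)) MM'|exact: IH].
Qed.

Lemma Ck_continuous p (f : 'rV[R]_d -> R) : Ck p f -> continuous f.
Proof. by elim: p f => [//|p IH] f Cf; exact/IH/CkW. Qed.

Lemma locally_close (f : 'rV[R]_d -> R) w0 (e : R) : {for w0, continuous f} ->
  0 < e -> \forall n \near \oo, forall w,
    `|w - w0| < n.+1%:R^-1 -> `|f w0 - f w| < e.
Proof.
move=> cf e0; have /cvgrPdist_lt/(_ _ e0)/nbhs_ballP[r /= r0 He] := cf.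
near=> n => w wn; apply: He; rewrite -ball_normE /= distrC; apply: lt_trans wn _.
by near: n; exact: (near_infty_natSinv_lt (PosNum r0)).
Unshelve. all: by end_near. Qed.

Lemma locally_bounded (f : 'rV[R]_d -> R) w0 : {for w0, continuous f} ->
  \forall n \near \oo, forall w, `|w - w0| < n.+1%:R^-1 -> `|f w| <= n.+1%:R.
Proof.
move=> cf; apply: filterS2 (locally_close cf ltr01) (nbhs_infty_ger `|f w0|).
move=> n close fn w /close fw; have -> : f w = f w0 - (f w0 - f w) by rewrite subKr.
apply: le_trans (ler_normB _ _) _.
by rewrite -natr1 lerD // ltW.
Qed.

(** One index [n] sets both the radius and the bound, so finitely many such requirements hold
    together for large [n]. *)
Lemma partials_locally_bounded p (f : 'rV[R]_d -> R) w0 : Ck p f ->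
  \forall n \near \oo, partials_bounded p [set w | `|w - w0| < n.+1%:R^-1] n.+1%:R f.
Proof.
elim: p f => [|p IH] f Cf /=; first exact: nearW.
apply: filter_forall => i; case: Cf => _ /(_ i) Cfi.
apply: filterS2 (locally_bounded (Ck_continuous Cfi (x := w0))) (IH _ Cfi).
by move=> n; split.
Qed.

End LocalFlow.

(** * Matching the flow with the round *)

Section Drift.
Context {R : realType} {d m E : nat}.
Hypotheses (m0 : (0 < m)%N) (E0 : (0 < E)%N).

Let combination (a : 'rV[R]_d) (b : 'I_m -> 'rV[R]_d) (c : 'I_m -> 'I_E -> 'rV[R]_d) :=
  2^-1 *: (a - (m%:R^-1 *: \sum_(j < m) b j -
     E%:R^-1 *: (m%:R^-1 *: \sum_(j < m) (E%:R^-1 *: \sum_(i < E) c j i)))).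

Let combinationB a a' b b' c c' :
  combination a b c - combination a' b' c' =
  combination (a - a') (fun j => b j - b' j) (fun j i => c j i - c' j i).
Proof.
rewrite /combination.
under [X in _ = _ *: (_ - (_ - _ *: (_ *: X)))]eq_bigr do rewrite sumrB scalerBr.
rewrite !sumrB.
set b1 := \sum_(j < m) b j; set b2 := \sum_(j < m) b' j.
set c1 := \sum_(j < m) _ *: \sum_(i < E) c j i.
set c2 := \sum_(j < m) _ *: \sum_(i < E) c' j i.
by apply/rowP => i; rewrite !mxE; ring.
Qed.

(** Half of three terms of size at most [k], rounded up from [3 * k / 2]; the extra [E^-1] is at
    most 1. Since [combination] is linear, this bounds both the drift and its increments. *)
Lemma drift_combination (a : 'rV[R]_d) (b : 'I_m -> 'rV[R]_d)
    (c : 'I_m -> 'I_E -> 'rV[R]_d) (k : R) :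
  `|a| <= k -> (forall j, `|b j| <= k) -> (forall j i, `|c j i| <= k) ->
  `|combination a b c| <= 2 * k.
Proof.
move=> ak bk ck; have k0 : 0 <= k by exact: le_trans ak.
have bk' : `|m%:R^-1 *: \sum_(j < m) b j| <= k by exact: normr_mean.
have ck' : `|E%:R^-1 *: (m%:R^-1 *: \sum_(j < m) (E%:R^-1 *: \sum_(i < E) c j i))| <= k.
  rewrite normrZ normfV normr_nat; apply: (@le_trans _ _ (1 * k)); last by rewrite mul1r.
  apply: ler_pM; rewrite ?invr_ge0 //; first by rewrite invf_le1 ?ler1n ?ltr0n.
  by apply: normr_mean => // j; exact: normr_mean.
rewrite normrZ ger0_norm ?invr_ge0 //.
have H : forall u v w : 'rV[R]_d, `|u| <= k -> `|v| <= k -> `|w| <= k ->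
    `|u - (v - w)| <= 3 * k.
  move=> u v w uk vk wk; have := ler_normB u (v - w); have := ler_normB v w; lra.
by have := H _ _ _ ak bk' ck'; lra.
Qed.

Variable L : 'I_m -> 'I_E -> 'rV[R]_d -> R.
Hypothesis CL : forall j k, Ck 3 (L j k).

Definition drift_bound (M : R) : R := 4 * (@jet_bound R d M) ^+ 2.

Lemma drift_bounds (A : set 'rV[R]_d) (M : R) : segment_closed A -> 0 <= M ->
  (forall j k, partials_bounded 3 A M (L j k)) ->
  (forall x, A x -> `|drift L x| <= drift_bound M) /\
  (forall x y, A x -> A y -> `|drift L y - drift L x| <= drift_bound M * `|y - x|).
Proof.
move=> segA M0 bL.
have [g1 g2] := self_force_bounds segA M0 (Ck_global CL)
  (partials_bounded_global m0 E0 CL bL).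
have c12 j := self_force_bounds segA M0 (Ck_client CL j)
  (partials_bounded_client E0 CL j bL).
have l12 j k := self_force_bounds segA M0 (CL j k) (bL j k).
have -> : drift_bound M = 2 * (2 * (@jet_bound R d M) ^+ 2).
  by rewrite /drift_bound; ring.
split=> [x Ax|x y Ax Ay].
  apply: drift_combination => [|j|j k]; first exact: g1.
    by case: (c12 j) => + _; exact.
  by case: (l12 j k) => + _; exact.
have driftE w : drift L w = combination (self_force (global_loss L) w)
    (fun j => self_force (client_loss L j) w) (fun j k => self_force (L j k) w).
  by [].
rewrite !driftE combinationB.
rewrite -mulrA; apply: drift_combination => [|j|j k]; first exact: g2.
  by case: (c12 j) => _; exact.
by case: (l12 j k) => _; exact.
Qed.

End Drift.

Section Matching.
Context {R : realType} {d m E : nat}.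
Variable L : 'I_m -> 'I_E -> 'rV[R]_d -> R.
Hypotheses (m0 : (0 < m)%N) (E0 : (0 < E)%N) (CL : forall j k, Ck 3 (L j k)).
Variables (M rho : R) (w0 : 'rV[R]_d).
Hypotheses (M0 : 0 <= M) (rho0 : 0 < rho).
Let ball0 := [set w : 'rV[R]_d | `|w - w0| < rho].
Hypothesis bL : forall j k, partials_bounded 3 ball0 M (L j k).

Let K := @jet_bound R d M.
Let D := @drift_bound R d M.
Let K0 : 0 <= K. Proof. by rewrite mulr_ge0. Qed.
Let D0 : 0 <= D. Proof. by rewrite mulr_ge0 // sqr_ge0. Qed.

Lemma global_field_bounds :
  field_bounds ball0 K (grad (global_loss L)) (hess (global_loss L)).
Proof.
apply: grad_bounds => //; first exact: ball_segment_closed.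
  exact: Ck_global.
exact: partials_bounded_global.
Qed.

Lemma expected_round_near (eta : R) : 0 <= eta -> E%:R * eta * K < rho ->
  `|expected_round L eta w0 - round_approx L eta w0|
    <= 2 * K ^+ 3 * (E%:R * eta) ^+ 3.
Proof.
move=> eta0 hK; apply: (expected_round_expansion m0 E0 CL (A := ball0)) => //.
  by move=> w wh; exact: le_lt_trans wh hK.
by move=> j k; apply: grad_bounds => //; exact: ball_segment_closed.
Qed.

(** For [h] up to this value, [h <= 1], the Picard condition [h * (K + D) <= 1/2] holds, and a path
    of speed [K + D] stays strictly within [rho] up to time [h]. *)
Definition horizon : R := Num.min rho 1 / (2 * (K + D + 1)).

(** The factor [d.+1] converts norms and [2 * K ^+ 3] is the error of the round. The rest is the
    bound of [flow_expansion] with speed [K + D], [eps] equal to [h * D * ((K + D) * h)] and [sigma]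
    equal to [h * D], after one surplus [h] is bounded by 1. *)
Definition match_constant : R :=
  d.+1%:R * (2 * K ^+ 3 + (K * (K + D) ^+ 2
    + K * (K * (K + D) + D * (K + D) + D) + D * (K + D))).

Lemma flow_matches_near :
  flow_matches_round L (fedavg_modified_loss L) match_constant horizon w0.
Proof.
move=> eta eta0 hd; set h := E%:R * eta in hd *.
have h0 : 0 < h by rewrite mulr_gt0 // ltr0n.
have k1 : 0 < K + D + 1 by rewrite ltr_wpDl // addr_ge0.
have hk : h * (2 * (K + D + 1)) <= Num.min rho 1.
  by move: hd; rewrite /horizon ler_pdivlMr // mulr_gt0.
have hk1 : h * (2 * (K + D + 1)) <= 1 by rewrite (le_trans hk) // ge_min lexx orbT.
have hkr : h * (2 * (K + D + 1)) <= rho by rewrite (le_trans hk) // ge_min lexx.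
have KD0 : 0 <= K + D by exact: addr_ge0.
have hKD : 0 <= h * (K + D) by rewrite mulr_ge0 // ltW.
have hKDE : h * (2 * (K + D + 1)) = 2 * (h * (K + D)) + 2 * h by ring.
have h1 : h <= 1 by lra.
have hB : (K + D) * h < rho by rewrite mulrC; lra.
have hL : h * (K + D) <= 2^-1 by lra.
have hK : h * K < rho.
  by apply: le_lt_trans hB; rewrite mulrC; apply: ler_wpM2r; [exact: ltW|rewrite lerDl].
have segA := @ball_segment_closed R d w0 rho.
have [f1 f2 f3 f4] := global_field_bounds.
have [d1 d2] := drift_bounds m0 E0 CL segA M0 bL.
have Aw0 : ball0 w0 by rewrite /ball0 /= subrr normr0.
have XB w : ball0 w -> `|grad (global_loss L) w + h *: drift L w| <= K + D.
  move=> Aw; apply: le_trans (ler_normD _ _) _; apply: lerD; first exact: f1.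
  rewrite normrZ gtr0_norm //; apply: (@le_trans _ _ (1 * D)); last by rewrite mul1r.
  by apply: ler_pM => //; [exact: ltW|exact: d1].
have gradE w : grad (fedavg_modified_loss L eta) w
    = grad (global_loss L) w + h *: drift L w.
  exact: grad_fedavg_modified_loss.
split.
- have [||g [g0 cg Dg]] := @local_flow_exists R d
    (fun w => - grad (fedavg_modified_loss L eta) w) (K + D) (K + D) h rho w0
    KD0 KD0 h0 hL hB.
  + by move=> w Aw; rewrite normrN gradE XB.
  + move=> x y Ax Ay; rewrite -opprB normrN opprK addrC !gradE.
    have -> : grad (global_loss L) x + h *: drift L x
        - (grad (global_loss L) y + h *: drift L y)
      = (grad (global_loss L) x - grad (global_loss L) y)
        + h *: (drift L x - drift L y).
      move: (grad _ x) (grad _ y) (drift L x) (drift L y) => a b a' b'.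
      by apply/rowP => i; rewrite !mxE; ring.
    rewrite mulrDl; apply: le_trans (ler_normD _ _) _; apply: lerD; first exact: f2.
    rewrite normrZ gtr0_norm // -[leRHS]mul1r.
    by apply: ler_pM => //; [exact: ltW|exact: d2].
  by exists g; split.
- move=> g [g0 cg Dg].
  have := @flow_expansion R d ball0 K (K + D) h rho (h * D * ((K + D) * h)) (h * D)
    w0 (grad (global_loss L)) (fun w => h *: drift L w) (hess (global_loss L))
    K0 KD0 (ltW h0) rho0 global_field_bounds (fun w Aw => Aw) hB XB.
  move=> /(_ _ _ g g0 cg) H.
  have {H}flowE : `|g h - round_approx L eta w0| <= h ^+ 3 * (K * (K + D) ^+ 2
      + K * (K * (K + D) + D * (K + D) + D) + D * (K + D)).
    apply: le_trans (H _ _ _) _.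
    + move=> w wB; have Aw : ball0 w by exact: le_lt_trans wB hB.
      rewrite -scalerBr normrZ gtr0_norm // -mulrA ler_wpM2l ?(ltW h0) //.
      by apply: (le_trans (d2 _ _ _ _)) => //; rewrite ler_wpM2l.
    + by rewrite normrZ gtr0_norm // ler_wpM2l ?(ltW h0) // d1.
    + by move=> t tT; rewrite -gradE; exact: Dg.
    rewrite -subr_ge0.
    have -> : h ^+ 3 * (K * (K + D) ^+ 2 + K * (K * (K + D) + D * (K + D) + D)
        + D * (K + D)) - h * (K * ((K + D) * h) ^+ 2
        + K * (h * (K * ((K + D) * h) + h * D * ((K + D) * h) + h * D))
        + h * D * ((K + D) * h))
      = h ^+ 3 * (K * (D * (K + D))) * (1 - h) by ring.
    by rewrite !mulr_ge0 ?exprn_ge0 ?subr_ge0 // ltW.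
  have roundE := expected_round_near (ltW eta0) hK.
  apply: le_trans (enorm_le _) _; rewrite /match_constant -mulrA ler_wpM2l //.
  rewrite -(subrKA (round_approx L eta w0)).
  apply: le_trans (ler_normD _ _) _; rewrite addrC mulrDl; apply: lerD.
    by rewrite distrC.
  by rewrite [leRHS]mulrC.
Qed.

End Matching.

(** * Uniqueness of the correction up to a constant *)

Section Uniqueness.
Context {R : realType} {d m E : nat}.
Variable L : 'I_m -> 'I_E -> 'rV[R]_d -> R.
Hypotheses (m0 : (0 < m)%N) (E0 : (0 < E)%N) (CL : forall j k, Ck 3 (L j k)).
Implicit Types w : 'rV[R]_d.

Lemma losses_locally_bounded w0 : exists rho M : R, [/\ 0 < rho, 0 <= M &
  forall j k, partials_bounded 3 [set w | `|w - w0| < rho] M (L j k)].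
Proof.
have [n _ nP] : \forall n \near \oo, forall p : 'I_m * 'I_E,
    partials_bounded 3 [set w | `|w - w0| < n.+1%:R^-1] n.+1%:R (L p.1 p.2).
  by apply: filter_forall => p; exact: partials_locally_bounded.
exists n.+1%:R^-1, n.+1%:R; split=> // j k.
exact: (nP n (leqnn n) (j, k)).
Qed.

Lemma modified_loss_matches w0 : exists C delta : R,
  0 < delta /\ flow_matches_round L (fedavg_modified_loss L) C delta w0.
Proof.
have [rho [M [rho0 M0 bL]]] := losses_locally_bounded w0.
exists (@match_constant R d M), (@horizon R d M rho); split.
  rewrite divr_gt0 ?lt_min ?rho0 //= mulr_gt0 // ltr_wpDl //.
  by rewrite addr_ge0 ?mulr_ge0 ?sqr_ge0.
exact: flow_matches_near.
Qed.

(** The flow of [Lt eta] and [round_approx] both approximate the same expected round. Subtracting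
    their expansions isolates [(h * eta) *: (q w0 - E%:R *: drift L w0)], bounded by
    [C' * h^3 + h * eta * e]; as [eta = h / E], division leaves [E * C' * h + e], at most [2 * e]
    for small [h]. *)
Lemma grad_correction_unique (Lt : R -> 'rV[R]_d -> R) (F1 : 'rV[R]_d -> R)
    (C delta : R) w0 : Ck 1 F1 ->
  (forall eta w, Lt eta w = global_loss L w + eta * F1 w) ->
  0 < delta -> flow_matches_round L Lt C delta w0 ->
  grad F1 w0 = grad (loss_correction L) w0.
Proof.
move=> CF1 LtE delta0 match_Lt; rewrite grad_loss_correction //.
have [rho [M [rho0 M0 bL]]] := losses_locally_bounded w0.
set K := @jet_bound R d M; set q := grad F1.
have K0 : 0 <= K by rewrite mulr_ge0.
have bG := @global_field_bounds R d m E L m0 E0 CL M rho w0 M0 bL.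
have [f1 _ _ _] := bG.
apply/eqP; rewrite -subr_eq0 -normr_le0; apply/ler_addgt0Pr => e2 e20; rewrite add0r.
pose e := Num.min (e2 / 2) 1.
have e0 : 0 < e by rewrite lt_min divr_gt0 //=.
have e1 : e <= 1 by rewrite ge_min lexx orbT.
have ee2 : 2 * e <= e2.
  have : e <= e2 / 2 by rewrite ge_min lexx.
  by lra.
have [rho1 [rho10 rho1r rho1q]] : exists rho1, [/\ 0 < rho1, rho1 <= rho &
    forall w, `|w - w0| < rho1 -> `|q w - q w0| <= e].
  have cq i : {for w0, continuous (partial i F1)} by case: CF1 => _; exact.
  have [n _ nP] : \forall n \near \oo, forall i w,
      `|w - w0| < n.+1%:R^-1 -> `|partial i F1 w0 - partial i F1 w| < e.
    by apply: filter_forall => i; exact: locally_close.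
  exists (Num.min n.+1%:R^-1 rho); split.
  - by rewrite lt_min invr_gt0 ltr0n rho0.
  - by rewrite ge_min lexx orbT.
  - move=> w; rewrite lt_min => /andP[wr _].
    apply: norm_rV_le => [|i]; first exact: ltW.
    by rewrite !mxE distrC ltW //; exact: (nP n (leqnn n)).
set Q := `|q w0| + 1.
have Q0 : 0 <= Q by rewrite addr_ge0.
set B := K + Q; have B0 : 0 <= B by rewrite addr_ge0.
(* Matching error, round error, then the flow error simplified by [eta <= h] and [e <= 1]; [|C|]
   appears because [C] may be negative. *)
pose C' := `|C| + 2 * K ^+ 3 + K * B ^+ 2 + K * (K * B + 1 + Q).
have C'0 : 0 <= C'.
  by rewrite /C' !addr_ge0 ?mulr_ge0 ?addr_ge0 ?mulr_ge0 ?exprn_ge0.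
have ER : 0 < E%:R :> R by rewrite ltr0n.
(* In turn: the matching applies, [eta <= 1], the flow stays where [q] varies by at most [e], and
   the cubic error is at most [e] after division. *)
pose h := Num.min (Num.min delta 1) (Num.min (rho1 / (2 * (B + 1))) (e / (E%:R * (C' + 1)))).
have B1 : 0 < 2 * (B + 1) by rewrite mulr_gt0 // ltr_wpDl.
have C1 : 0 < E%:R * (C' + 1) by rewrite mulr_gt0 // ltr_wpDl.
have h0 : 0 < h by rewrite !lt_min delta0 ltr01 !divr_gt0.
have hdelta : h <= delta by rewrite !ge_min lexx.
have h1 : h <= 1 by rewrite !ge_min lexx !orbT.
have hB : B * h < rho1.
  have : h <= rho1 / (2 * (B + 1)) by rewrite !ge_min lexx !orbT.
  rewrite ler_pdivlMr // => H.
  have hB0 : 0 <= h * B by rewrite mulr_ge0 // ltW.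
  have : h * (2 * (B + 1)) = 2 * (h * B) + 2 * h by ring.
  by rewrite [B * h]mulrC; lra.
have hC : E%:R * C' * h <= e.
  have : h <= e / (E%:R * (C' + 1)) by rewrite !ge_min lexx !orbT.
  rewrite ler_pdivlMr // => H; apply: le_trans H.
  rewrite mulrC; apply: ler_wpM2l; first exact: ltW.
  by rewrite ler_wpM2l ?(ltW ER) // lerDl.
pose eta := h / E%:R.
have etaE : E%:R * eta = h by rewrite /eta mulrC divfK // gt_eqF.
have eta0 : 0 < eta by rewrite divr_gt0.
have eta_h : eta <= h by rewrite -etaE ler_peMl ?ler1n // ltW.
have hK : h * K < rho.
  apply: lt_le_trans rho1r; apply: le_lt_trans hB; rewrite mulrC.
  by apply: ler_wpM2r; [exact: ltW|rewrite lerDl].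
have hd : E%:R * eta <= delta by rewrite etaE.
have [[g gF] /(_ g gF)] := match_Lt eta eta0 hd; rewrite etaE => gE.
case: gF; rewrite etaE => g0 cg Dg.
have gradLt w : grad (Lt eta) w = grad (global_loss L) w + eta *: q w.
  have -> : Lt eta = (fun w => global_loss L w + eta * F1 w).
    by apply/funext => u; exact: LtE.
  by rewrite grad_addZ //; [case: (Ck_global CL)|case: CF1].
have ball1 w : `|w - w0| < rho1 -> `|w - w0| < rho.
  by move=> wr; exact: lt_le_trans wr rho1r.
have XB w : `|w - w0| < rho1 -> `|grad (global_loss L) w + eta *: q w| <= B.
  move=> wr; apply: le_trans (ler_normD _ _) _; apply: lerD; first exact/f1/ball1.
  rewrite normrZ gtr0_norm // -[Q]mul1r; apply: ler_pM => //; [exact: ltW|lra|].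
  rewrite -(subrK (q w0) (q w)); apply: le_trans (ler_normD _ _) _.
  by rewrite /Q addrC lerD2l (le_trans (rho1q _ wr)).
have := @flow_expansion R d _ K B h rho1 (eta * e) (eta * Q)
  w0 (grad (global_loss L)) (fun w => eta *: q w) (hess (global_loss L))
  K0 B0 (ltW h0) rho10 bG ball1 hB XB.
move=> /(_ _ _ g g0 cg) H.
have {H}flowE := H _ _ _.
have {}flowE : `|g h - (w0 - h *: (grad (global_loss L) w0 + eta *: q w0)
    + (h ^+ 2 / 2) *: (grad (global_loss L) w0 *m hess (global_loss L) w0))|
    <= h * (K * (B * h) ^+ 2 + K * (h * (K * (B * h) + eta * e + eta * Q)) + eta * e).
  apply: flowE.
  - move=> w wB; rewrite -scalerBr normrZ gtr0_norm // ler_wpM2l ?(ltW eta0) //.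
    by apply: rho1q; exact: le_lt_trans wB hB.
  - by rewrite normrZ gtr0_norm // ler_wpM2l ?(ltW eta0) // /Q lerDl.
  - by move=> t tT; rewrite -gradLt; exact: Dg.
have roundE : `|expected_round L eta w0 - round_approx L eta w0| <= 2 * K ^+ 3 * h ^+ 3.
  rewrite -etaE; apply: (expected_round_near m0 E0 CL M0 bL (ltW eta0)).
  by rewrite etaE.
have matchE : `|g h - expected_round L eta w0| <= `|C| * h ^+ 3.
  apply: (le_trans (norm_le_enorm _)); apply: (le_trans gE).
  by rewrite ler_wpM2r ?exprn_ge0 ?(ltW h0) // ler_norm.
have heta : 0 < h * eta by exact: mulr_gt0.
suff : h * eta * `|q w0 - E%:R *: drift L w0| <= h * eta * (E%:R * C' * h + e).
  rewrite (ler_pM2l heta) => /le_trans; apply.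
  by apply: le_trans ee2; lra.
have -> : h * eta * `|q w0 - E%:R *: drift L w0|
    = `|(h * eta) *: (q w0 - E%:R *: drift L w0)|.
  by rewrite normrZ gtr0_norm.
have -> : (h * eta) *: (q w0 - E%:R *: drift L w0) =
  (g h - (w0 - h *: (grad (global_loss L) w0 + eta *: q w0)
    + (h ^+ 2 / 2) *: (grad (global_loss L) w0 *m hess (global_loss L) w0)))
  - (g h - expected_round L eta w0)
  - (expected_round L eta w0 - round_approx L eta w0).
  rewrite /round_approx /self_force etaE.
  move: (grad (global_loss L) w0 *m _) => a.
  move: (grad (global_loss L) w0) => b.
  move: (expected_round L eta w0) (drift L w0) (q w0) (g h) => a1 a2 a3 a4.
  by apply/rowP => i; rewrite !mxE -etaE; ring.
apply: le_trans (ler_normB _ _) _.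
apply: le_trans (lerD (le_trans (ler_normB _ _) (lerD flowE matchE)) roundE) _.
rewrite -subr_ge0.
have -> : h * eta * (E%:R * C' * h + e) = h ^+ 3 * C' + h * eta * e.
  by rewrite -etaE; ring.
have -> : h ^+ 3 * C' + h * eta * e
  - (h * (K * (B * h) ^+ 2 + K * (h * (K * (B * h) + eta * e + eta * Q)) + eta * e)
     + `|C| * h ^+ 3 + 2 * K ^+ 3 * h ^+ 3)
  = h ^+ 2 * K * ((h - eta * e) + Q * (h - eta)) by rewrite /C'; ring.
rewrite !mulr_ge0 ?exprn_ge0 ?(ltW h0) // addr_ge0 // ?mulr_ge0 ?subr_ge0 //.
by apply: le_trans eta_h; rewrite ler_piMr // ltW.
Qed.

(** Matching is required from every starting point, so [F1] and [loss_correction L] have the same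
    gradient everywhere. A mean value on the segment from 0 to [w] makes their difference constant,
    equal to its value at 0. *)
Lemma modified_loss_unique (Lt : R -> 'rV[R]_d -> R) : is_modified_loss L Lt ->
  exists c : R, forall (eta : R) w,
    Lt eta w = fedavg_modified_loss L eta w + eta * c.
Proof.
move=> [[F1 [CF1 LtE]] matches].
have CG := Ck_loss_correction CL.
have dF w : differentiable F1 w by case: CF1.
have dG w : differentiable (loss_correction L) w by case: CG.
have [f fE] : exists f : 'rV[R]_d -> R, f = (fun w => F1 w - loss_correction L w).
  by eexists.
exists (f 0) => eta w; rewrite LtE fedavg_modified_lossE // -addrA -mulrDr.
have -> : F1 w = loss_correction L w + f w by rewrite fE subrKC.
suff -> : f 0 = f w by [].
have df u : differentiable f u by rewrite fE; exact: differentiableB.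
have [t _] := mean_value_dir 0 w df.
rewrite add0r derive_partials // big1 => [/eqP|i _].
  by rewrite subr_eq0 => /eqP.
have [C [delta [delta0 match_u]]] := matches (0 + t *: w).
have := grad_correction_unique CF1 LtE delta0 match_u.
move=> /(congr1 (fun v : 'rV[R]_d => v 0 i)); rewrite /= !mxE => gE.
by rewrite fE partialB // gE subrr mulr0.
Qed.

End Uniqueness.

Unset Implicit Arguments.
Set Strict Implicit.

Theorem theorem1 (R : realType) (d : nat) :
  (forall (m E : nat), (0 < m)%N -> (0 < E)%N ->
   forall L : 'I_m -> 'I_E -> 'rV[R]_d -> R,
   (forall j k, Ck 3 (L j k)) ->
   [/\ is_modified_loss L (fedavg_modified_loss L),
       (forall Lt : R -> 'rV[R]_d -> R, is_modified_loss L Lt ->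
          exists c : R, forall (eta : R) (w : 'rV[R]_d),
            Lt eta w = fedavg_modified_loss L eta w + eta * c) &
       (E = 1%N ->
        forall l : 'I_E -> 'rV[R]_d -> R, sgd_loss l = global_loss L ->
        forall (eta : R) (w : 'rV[R]_d),
          fedavg_modified_loss L eta w = sgd_modified_loss l eta w)]) /\
  (* the constants in eta << 1/E and O(E^3 eta^3) do not depend on m, E *)
  (forall r M : R, 0 < r -> 0 < M ->
   exists C delta : R, 0 < delta /\
   forall (m E : nat), (0 < m)%N -> (0 < E)%N ->
   forall L : 'I_m -> 'I_E -> 'rV[R]_d -> R,
   (forall j k, Ck 3 (L j k)) ->
   forall w0 : 'rV[R]_d,
   (forall j k,
      partials_bounded 3 [set w | enorm (w - w0) < r] M (L j k)) ->
   flow_matches_round L (fedavg_modified_loss L) C delta w0).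
Proof.
split=> [m E m0 E0 L CL|r M r0 M0].
  split; last 1 first.
  - move=> E1; subst E => l lL eta w; exact: fedavg_single_step.
  - split; last exact: modified_loss_matches.
    exists (loss_correction L); split; first exact: Ck_loss_correction.
    exact: fedavg_modified_lossE.
  - exact: modified_loss_unique.
(* By [enorm_le], the sup-norm ball of this radius lies in the Euclidean ball of radius [r]. *)
pose rho := r / d.+1%:R; have rho0 : 0 < rho by rewrite divr_gt0.
exists (@match_constant R d M), (@horizon R d M rho).
split.
  rewrite divr_gt0 ?lt_min ?rho0 //= mulr_gt0 // ltr_wpDl //.
  by rewrite addr_ge0 ?mulr_ge0 ?sqr_ge0 // ltW.
move=> m E m0 E0 L CL w0 bL; apply: flow_matches_near => //; first exact: ltW.
move=> j k; apply: partials_boundedW (bL j k) => // w /= wr.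
apply: le_lt_trans (enorm_le _) _.
by move: wr; rewrite /rho ltr_pdivlMr // mulrC.
Qed.
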